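(* Let $\Gamma$ be the $\mathbb{Z}_2^5$-grading on the Albert algebra $\mathcal{A}$ over an algebraically closed field $\mathbb{F}$ of characteristic different from $2$, as defined in the context. Let $T$ be the subgroup of $\mathbb{Z}_2^5=\mathbb{Z}_2^2\times\mathbb{Z}_2^3$ generated by $c_1,c_2,c_3$, the standard basis of the factor $\mathbb{Z}_2^3$. Then $$W(\Gamma)=\{\mu\in\mathrm{Aut}(\mathbb{Z}_2^5)\;|\;\mu(T)=T\}.$$
   Context: Gradings and Weyl groups. For a grading $\Gamma:\mathcal{A}=\bigoplus_{g\in G}\mathcal{A}_g$ of a (nonassociative) algebra by an abelian group $G$ ($\mathcal{A}_g\mathcal{A}_h\subset\mathcal{A}_{g+h}$, additive notation), $\mathrm{Supp}\,\Gamma=\{g:\mathcal{A}_g\neq0\}$; $\mathrm{Aut}(\Gamma)$ is the group of algebra automorphisms of $\mathcal{A}$ permuting the nonzero components $\mathcal{A}_g$; $\mathrm{Stab}(\Gamma)$ is the subgroup of those leaving each component invariant; the Weyl group is $W(\Gamma)=\mathrm{Aut}(\Gamma)/\mathrm{Stab}(\Gamma)$. When $G$ is the universal abelian group of $\Gamma$ (i.e., for any realization of the same decomposition as a grading by an abelian group $H$ there is a unique homomorphism $G\to H$ restricting to the identity on the support), each $\varphi\in\mathrm{Aut}(\Gamma)$ induces a unique automorphism $u$ of $G$ with $\varphi(\mathcal{A}_s)=\mathcal{A}_{u(s)}$ for all $s\in\mathrm{Supp}\,\Gamma$, and in this way $W(\Gamma)$ is regarded as a subgroup of $\mathrm{Aut}(G)$.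 Cayley algebra. $\mathcal{C}$ is the $8$-dimensional algebra over $\mathbb{F}$ with basis $\{e_1,e_2,u_1,u_2,u_3,v_1,v_2,v_3\}$ and multiplication, indices of $u,v$ taken modulo $3$: $e_1^2=e_1$, $e_2^2=e_2$, $e_1e_2=e_2e_1=0$; $e_1u_i=u_i=u_ie_2$, $e_2v_i=v_i=v_ie_1$, $e_2u_i=u_ie_1=e_1v_i=v_ie_2=0$; $u_iv_i=-e_1$, $v_iu_i=-e_2$, $u_iv_j=v_iu_j=0$ for $i\ne j$; $u_i^2=v_i^2=0$; $u_iu_{i+1}=-u_{i+1}u_i=v_{i+2}$, $v_iv_{i+1}=-v_{i+1}v_i=u_{i+2}$. Its norm $n$ is the multiplicative quadratic form with polar form $n(x,y)=n(x+y)-n(x)-n(y)$, where all basis elements are isotropic, $n(e_1,e_2)=n(u_i,v_i)=1$, and all other pairs of distinct basis elements are orthogonal; $\bar x=n(x,1)1-x$. $\mathbb{Z}_2^3$-grading on $\mathcal{C}$. $\mathcal{C}$ is obtained by repeated Cayley--Dickson doubling: $\mathcal{K}=\mathbb{F}1\oplus\mathbb{F}w_1$, $\mathcal{Q}=\mathcal{K}\oplus\mathcal{K}w_2$, $\mathcal{C}=\mathcal{Q}\oplus\mathcal{Q}w_3$ with $w_i^2=1$; concretely one may take $w_1=e_1-e_2$, $w_2=u_1-v_1$, $w_3=u_2-v_2$. Setting $\deg w_i=c_i$ determines a $\mathbb{Z}_2^3$-grading on $\mathcal{C}$ with one-dimensional components. Albert algebra. $\mathcal{A}$ is the algebra of Hermitian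 $3\times3$ matrices $\begin{pmatrix}\alpha_1&\bar a_3&a_2\\ a_3&\alpha_2&\bar a_1\\ \bar a_2&a_1&\alpha_3\end{pmatrix}$ ($\alpha_i\in\mathbb{F}$, $a_i\in\mathcal{C}$) with product $XY=\frac12(X\cdot Y+Y\cdot X)$, where $X\cdot Y$ is the usual matrix product. $E_i$ denotes the matrix with $\alpha_i=1$ and all other parameters $0$; $\iota_i(a)$ denotes the matrix with $a_i=2a$ and all other parameters $0$. So $\mathcal{A}=\bigoplus_{i=1}^3(\mathbb{F}E_i\oplus\iota_i(\mathcal{C}))$, the $E_i$ are orthogonal idempotents with sum $1$, and (indices modulo 3) $E_i\iota_i(a)=0$, $E_{i+1}\iota_i(a)=\frac12\iota_i(a)=E_{i+2}\iota_i(a)$, $\iota_i(a)\iota_{i+1}(b)=\iota_{i+2}(\bar a\bar b)$, $\iota_i(a)\iota_i(b)=2n(a,b)(E_{i+1}+E_{i+2})$. The $\mathbb{Z}_2^5$-grading on $\mathcal{A}$. Let $\{a,b\}$ be the standard basis of $\mathbb{Z}_2^2$. The grading $\Gamma$ is given by $\deg E_i=0$ ($i=1,2,3$), $\deg\iota_1(x)=a+\deg x$, $\deg\iota_2(x)=b+\deg x$, $\deg\iota_3(x)=a+b+\deg x$ for nonzero homogeneous $x\in\mathcal{C}$; equivalently, it is determined by $\deg\iota_1(1)=a$, $\deg\iota_2(1)=b$, $\deg\iota_3(w_j)=a+b+c_j$, $j=1,2,3$. Its universal abelian group is $\mathbb{Z}_2^5$. *)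

(* Defs.v *)
From HB Require Import structures.
From mathcomp Require Import all_boot all_order all_algebra all_fingroup.
From mathcomp Require Import boolp classical_sets ring.

Set Implicit Arguments.
Unset Strict Implicit.
Unset Printing Implicit Defensive.

Import GRing.Theory.
Local Open Scope ring_scope.

(* A nonassociative algebra is a vectType [A] with a product [mul]; a grading
   by [G] is the family of its homogeneous components. *)
Section Gradings.
Variables (F : fieldType) (A : vectType F) (mul : A -> A -> A).
Variables (G : finZmodType) (Gam : G -> {vspace A}).
Local Open Scope classical_set_scope.

Definition is_grading : Prop :=
  [/\ (\sum_g Gam g)%VS = fullv, directv (\sum_g Gam g)%VS &
      forall g h x y, x \in Gam g -> y \in Gam h -> mul x y \in Gam (g + h)].

Definition Supp : {set G} := [set g | Gam g != 0%VS]%SET.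

(* A realization of the same decomposition as a grading by an abelian group H
   amounts to an injective relabelling [d] of the support. *)
Definition is_realization (H : zmodType) (d : G -> H) : Prop :=
  {in Supp &, injective d} /\
  {in Supp &, forall g h, forall x y, x \in Gam g -> y \in Gam h ->
    mul x y != 0 -> d (g + h) = d g + d h}.

Definition is_universal : Prop :=
  forall (H : zmodType) (d : G -> H), is_realization d ->
    exists! f : G -> H, zmod_morphism f /\ {in Supp, f =1 d}.

Definition is_alg_aut (phi : 'End(A)) : Prop :=
  lker phi = 0%VS /\ forall x y, phi (mul x y) = mul (phi x) (phi y).

Definition components : set {vspace A} := [set Gam g | g in [set` Supp]].

Definition Aut_gr : set 'End(A) :=
  [set phi | is_alg_aut phi /\
             [set (phi @: U)%VS | U in components] = components].

Definition Stab_gr : set 'End(A) :=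
  [set phi | is_alg_aut phi /\
             {in Supp, forall g, (phi @: Gam g)%VS = Gam g}].

Definition Weyl : set (set 'End(A)) :=
  [set [set (phi \o sigma)%VF | sigma in Stab_gr] | phi in Aut_gr].

Definition induces (phi : 'End(A)) (u : G -> G) : Prop :=
  {in Supp, forall s, (phi @: Gam s)%VS = Gam (u s)}.

(* The Weyl group regarded as a subgroup of Aut(G); see [Aut_gr_induces] and
   [Weyl_induces_inj] for why this identification is legitimate when [G] is
   the universal group. *)
Definition Weyl_in_Aut : set {perm G} :=
  [set u | u \in Aut [set: G]%SET /\
           exists2 w, Weyl w & forall phi, w phi -> induces phi u].


Lemma component_inj : directv (\sum_g Gam g)%VS -> {in Supp &, injective Gam}.
Proof.
move=> /directv_sumP dG g h; rewrite !inE => g0 h0 e; apply: contraNeq g0 => ne.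
rewrite -subv0 -(dG g) // subv_cap subvv e /=.
by apply: (sumv_sup h) => //; rewrite eq_sym.
Qed.

Lemma limgK (phi : 'End(A)) (U : {vspace A}) :
  lker phi = 0%VS -> (phi^-1 @: (phi @: U))%VS = U.
Proof. by move/eqP=> k0; rewrite -limg_comp lker0_compVf // lim1g. Qed.

Lemma limgVK (phi : 'End(A)) (U : {vspace A}) :
  lker phi = 0%VS -> (phi @: (phi^-1 @: U))%VS = U.
Proof. by move/eqP=> k0; rewrite -limg_comp lker0_compfV // lim1g. Qed.

Lemma is_alg_autV phi : is_alg_aut phi -> is_alg_aut phi^-1%VF.
Proof.
move=> [k0 pM]; have k0' := introT eqP k0; split.
  apply/eqP/lker0P => x y e.
  by rewrite -(lker0_lfunVK k0' x) e lker0_lfunVK.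
move=> x y; rewrite -{1}(lker0_lfunVK k0' x) -{1}(lker0_lfunVK k0' y) -pM.
exact: lker0_lfunK.
Qed.

Lemma is_alg_autM phi psi :
  is_alg_aut phi -> is_alg_aut psi -> is_alg_aut (phi \o psi)%VF.
Proof.
move=> [k1 m1] [k2 m2]; split; last by move=> x y; rewrite !lfunE /= m2 m1.
apply/eqP/lker0P => x y; rewrite !lfunE /=.
by move/(lker0P (introT eqP k1))/(lker0P (introT eqP k2)).
Qed.

Lemma Aut_grV phi : Aut_gr phi -> Aut_gr phi^-1%VF.
Proof.
move=> [aphi e]; split; first exact: is_alg_autV.
rewrite -{1}e; apply/seteqP; split=> [U [_ [V hV <-] <-]|U hU].
  by rewrite limgK //; case: aphi.
by exists (phi @: U)%VS; [exists U | rewrite limgK //; case: aphi].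
Qed.

Lemma Aut_gr_degree phi : is_grading -> Aut_gr phi ->
  exists2 d : G -> G, is_realization d &
    {in Supp, forall s, d s \in Supp} /\ induces phi d.
Proof.
move=> [_ dG mG] [aphi e].
have /choice [d hd] : forall s, exists t,
    s \in Supp -> t \in Supp /\ (phi @: Gam s)%VS = Gam t.
  move=> s; have [sS|sS] := boolP (s \in Supp); last by exists s.
  have : components (phi @: Gam s)%VS by rewrite -e; exists (Gam s) => //; exists s.
  by case=> t tS et; exists t => _; rewrite et.
exists d; last by split=> s /hd [].
split=> [s t sS tS est|g h gS hS x y xg yh nz].
  apply: (component_inj dG sS tS).
  rewrite -(limgK (Gam s) aphi.1) -(limgK (Gam t) aphi.1).
  by rewrite (hd _ sS).2 (hd _ tS).2 est.
have in_Supp k z : z \in Gam k -> z != 0 -> k \in Supp.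
  rewrite !inE => zk; apply: contraNneq => k0.
  by move: zk; rewrite k0 memv0.
have ghS := in_Supp _ _ (mG _ _ _ _ xg yh) nz.
have p0 : phi (mul x y) != 0.
  by apply: contraNneq nz => z0; rewrite -memv0 -aphi.1 memv_ker z0.
have xd : phi x \in Gam (d g) by rewrite -(hd _ gS).2 memv_img.
have yd : phi y \in Gam (d h) by rewrite -(hd _ hS).2 memv_img.
have pd : phi (mul x y) \in Gam (d (g + h)).
  by rewrite -(hd _ ghS).2 memv_img // mG.
have pd' : phi (mul x y) \in Gam (d g + d h) by rewrite aphi.2 mG.
apply: contraNeq p0 => ne; rewrite -memv0 -(directv_sumP dG (d (g + h))) //.
rewrite memv_cap pd /=; apply: subvP pd'.
by apply: (sumv_sup (d g + d h)) => //; rewrite eq_sym.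
Qed.

Lemma Aut_gr_additive phi : is_grading -> is_universal -> Aut_gr phi ->
  exists2 f : G -> G, zmod_morphism f &
    {in Supp, forall s, f s \in Supp} /\ induces phi f.
Proof.
move=> gG uG /(Aut_gr_degree gG) [d rd [dS id]].
have [f [[fM fd] _]] := uG _ _ rd.
by exists f => //; split=> s sS; rewrite fd //; [apply: dS | apply: id].
Qed.

(* If G is universal then each element of Aut(Gam) induces a unique
   automorphism of G. *)
Lemma Aut_gr_induces phi : is_grading -> is_universal -> Aut_gr phi ->
  exists! u : {perm G}, u \in Aut [set: G]%SET /\ induces phi u.
Proof.
move=> gG uG aphi; have [_ dG _] := gG; have k0 := aphi.1.1.
have [f fM [fS fI]] := Aut_gr_additive gG uG aphi.
have [h hM [hS hI]] := Aut_gr_additive gG uG (Aut_grV aphi).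
have rid : is_realization (id : G -> G) by split=> [s t _ _|].
have [i [_ ui]] := uG _ _ rid.
have uniq_id k : zmod_morphism k -> {in Supp, k =1 id} -> k = id.
  move=> kM kS; rewrite -(ui _ (conj kM kS)); apply: ui.
  by split=> // s t.
have hf : h \o f = id.
  apply: uniq_id => [x y|s sS] /=; first by rewrite fM hM.
  apply: (component_inj dG); rewrite ?hS ?fS //.
  by rewrite -hI ?fS // -fI // limgK.
have f_inj : injective f by apply: (can_inj (g := h)) => x; apply: (congr1 (@^~ x) hf).
exists (perm f_inj); split=> [|v [vA vI]].
  split=> [|s sS]; last by rewrite permE fI.
  rewrite inE; apply/andP; split; first by apply/fintype.subsetP => x; rewrite inE.
  have f0 : f 0 = 0 by rewrite -{1}(subrr (0 : G)) fM subrr.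
  have fN y : f (- y) = - f y by rewrite -sub0r fM f0 sub0r.
  apply/morphicP => x y _ _; rewrite !permE.
  by rewrite -[(x * y)%g]/(x + y) -{1}(opprK y) fM fN opprK.
have vD x y : v (x + y) = v x + v y.
  by move: vA; rewrite inE => /andP[_ /morphicP]; apply; rewrite inE.
have v0 : v 0 = 0 by apply: (addrI (v 0)); rewrite -vD !addr0.
have vM : zmod_morphism v.
  move=> x y; rewrite vD; congr (_ + _); apply: (addrI (v y)).
  by rewrite -vD !subrr.
have fh : f \o h = id.
  apply: uniq_id => [x y|s sS] /=; first by rewrite hM fM.
  apply: (component_inj dG); rewrite ?fS ?hS //.
  by rewrite -fI ?hS // -hI // limgVK.
have hv : h \o v = id.
  apply: uniq_id => [x y|s sS] /=; first by rewrite vM hM.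
  have vS : v s \in Supp.
    by have := fS _ sS; rewrite !inE -fI // -vI.
  by apply: (component_inj dG); rewrite ?hS // -hI // -vI // limgK.
apply/permP => x; rewrite permE -[in LHS](congr1 (@^~ x) hv : h (v x) = x).
exact: (congr1 (@^~ (v x)) fh).
Qed.

Lemma Stab_grV phi : Stab_gr phi -> Stab_gr phi^-1%VF.
Proof.
move=> [aphi st]; split; first exact: is_alg_autV.
by move=> g gS; rewrite -{1}(st _ gS) limgK //; case: aphi.
Qed.

(* ... and the elements of Aut(Gam) that induce the same automorphism form
   one coset of Stab(Gam). *)
Lemma Weyl_induces_inj w1 w2 (u : G -> G) : Weyl w1 -> Weyl w2 ->
  (forall phi, w1 phi -> induces phi u) ->
  (forall phi, w2 phi -> induces phi u) -> w1 = w2.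
Proof.
have id_Stab : Stab_gr \1%VF.
  split=> [|g _]; last by rewrite lim1g.
  by split=> [|x y]; [apply/eqP/lker0P => x y | ]; rewrite !lfunE.
have sub v1 v2 : Weyl v1 -> Weyl v2 ->
  (forall phi, v1 phi -> induces phi u) ->
  (forall phi, v2 phi -> induces phi u) -> v1 `<=` v2.
  move=> [p1 [a1 _] <-] [p2 [a2 _] <-] i1 i2 _ [s sS <-].
  have k2 : lker p2 == 0%VS by apply/eqP; case: a2.
  exists (p2^-1 \o (p1 \o s))%VF; last first.
    by rewrite !comp_lfunA lker0_compfV // comp_lfun1l.
  split=> [|g gS].
    by apply: is_alg_autM; [exact: is_alg_autV | apply: is_alg_autM => //; case: sS].
  rewrite limg_comp (i1 (p1 \o s)%VF) //; last by exists s.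
  rewrite -(i2 p2) // ?limgK ?(eqP k2) //.
  by exists \1%VF; rewrite ?comp_lfun1r.
by move=> *; apply/seteqP; split; apply: sub.
Qed.

End Gradings.

(* The basis e1, e2, u_i, v_i of the Cayley algebra, with i taken modulo 3. *)
Inductive cayley_basis := Be1 | Be2 | Bu of 'Z_3 | Bv of 'Z_3.

Definition cayley_basis_enc (s : cayley_basis) : bool + ('Z_3 + 'Z_3) :=
  match s with
  | Be1 => inl true | Be2 => inl false
  | Bu i => inr (inl i) | Bv i => inr (inr i)
  end.
Definition cayley_basis_dec (s : bool + ('Z_3 + 'Z_3)) : cayley_basis :=
  match s with
  | inl true => Be1 | inl false => Be2
  | inr (inl i) => Bu i | inr (inr i) => Bv i
  end.
Lemma cayley_basis_encK : cancel cayley_basis_enc cayley_basis_dec.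
Proof. by case. Qed.
HB.instance Definition _ :=
  Finite.copy cayley_basis (can_type cayley_basis_encK).

Section Cayley.
Variable F : fieldType.

Definition cayley : vectType F := {ffun cayley_basis -> F^o}.
Implicit Types x y : cayley.

Definition cb (s : cayley_basis) : cayley := [ffun r => (r == s)%:R].

Definition cayley_table (s t : cayley_basis) : cayley :=
  match s, t with
  | Be1, Be1 => cb Be1
  | Be2, Be2 => cb Be2
  | Be1, Bu i => cb (Bu i)
  | Bu i, Be2 => cb (Bu i)
  | Be2, Bv i => cb (Bv i)
  | Bv i, Be1 => cb (Bv i)
  | Bu i, Bv j => if i == j then - cb Be1 else 0
  | Bv i, Bu j => if i == j then - cb Be2 else 0
  | Bu i, Bu j => if j == i + 1 then cb (Bv (i + 2))
                  else if i == j + 1 then - cb (Bv (j + 2)) else 0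
  | Bv i, Bv j => if j == i + 1 then cb (Bu (i + 2))
                  else if i == j + 1 then - cb (Bu (j + 2)) else 0
  | _, _ => 0
  end.

Definition cayley_mul x y : cayley :=
  \sum_s \sum_t (x s * y t) *: cayley_table s t.

Definition cayley1 : cayley := cb Be1 + cb Be2.

Definition cayley_norm x : F := x Be1 * x Be2 + \sum_i x (Bu i) * x (Bv i).

Definition cayley_polar x y : F :=
  cayley_norm (x + y) - cayley_norm x - cayley_norm y.

Definition cayley_bar x : cayley := cayley_polar x cayley1 *: cayley1 - x.

Definition w1 : cayley := cb Be1 - cb Be2.
Definition w2 : cayley := cb (Bu 1) - cb (Bv 1).
Definition w3 : cayley := cb (Bu 2) - cb (Bv 2).

(* The homogeneous component of degree t_1 c_1 + t_2 c_2 + t_3 c_3 is the line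
   spanned by (w_1^t_1 w_2^t_2) w_3^t_3, as read off from the three
   Cayley-Dickson doublings. *)
Definition w_pow (w : cayley) (k : 'F_2) : cayley :=
  if k == 0 then cayley1 else w.
Definition w_mon (t : 'rV['F_2]_3) : cayley :=
  cayley_mul (cayley_mul (w_pow w1 (t 0 0)) (w_pow w2 (t 0 1)))
             (w_pow w3 (t 0 2)).
Definition cayley_grading (t : 'rV['F_2]_3) : {vspace cayley} := <[w_mon t]>%VS.

End Cayley.

Section Albert.
Variable F : fieldType.
Local Notation C := (cayley F).

(* An element (alpha, a) consists of the parameters of the Hermitian matrix
   [albert_mx (alpha, a)], rows and columns being indexed modulo 3:
   a_i is the entry (i+2, i+1) and its conjugate the entry (i+1, i+2). *)
Definition albert : vectType F :=
  ({ffun 'Z_3 -> F^o} * {ffun 'Z_3 -> C})%type.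
Implicit Types X Y : albert.

Definition albert_mx X : 'M[C]_3 :=
  \matrix_(r, s) if r == s :> 'Z_3 then X.1 r *: cayley1 F
                 else if s == r + 1 :> 'Z_3 then cayley_bar (X.2 (r + 2))
                 else X.2 (s + 2).

Definition cayley_mulmx (M N : 'M[C]_3) : 'M[C]_3 :=
  \matrix_(r, s) \sum_k cayley_mul (M r k) (N k s).

Definition jordan_mx X Y : 'M[C]_3 :=
  map_mx ( *:%R 2^-1) (cayley_mulmx (albert_mx X) (albert_mx Y)
                       + cayley_mulmx (albert_mx Y) (albert_mx X)).

(* Recovers the parameters of the Hermitian matrix [jordan_mx X Y]. *)
Definition albert_mul X Y : albert :=
  ([ffun i => jordan_mx X Y i i Be1],
   [ffun i => jordan_mx X Y (i + 2) (i + 1)]).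

Definition albertE (i : 'Z_3) : albert := ([ffun j => (j == i)%:R], 0).

Definition albert_iota (i : 'Z_3) (x : C) : albert :=
  (0, [ffun j => if j == i then 2 *: x else 0]).

Definition Z2_5 : finZmodType := 'rV['F_2]_(2 + 3).

Definition deg_a : Z2_5 := row_mx (delta_mx 0 0) 0.
Definition deg_b : Z2_5 := row_mx (delta_mx 0 1) 0.
Definition deg_T (t : 'rV['F_2]_3) : Z2_5 := row_mx 0 t.
Definition deg_c (j : 'I_3) : Z2_5 := deg_T (delta_mx 0 j).

(* The shift in degree caused by iota_i, where iota_3 = iota_0. *)
Definition deg_iota (i : 'Z_3) : Z2_5 :=
  if i == 1 then deg_a else if i == 2 then deg_b else deg_a + deg_b.

Definition Z2_5_grading (g : Z2_5) : {vspace albert} :=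
  ((if (g == 0)%R then \sum_i <[albertE i]> else 0)
   + \sum_i \sum_(t | (deg_iota i + deg_T t == g)%R)
       (linfun (albert_iota i) @: cayley_grading F t))%VS.

Definition T_sub : {set Z2_5} := <<[set deg_c j | j : 'I_3]>>%g.

End Albert.

(* The decomposition [Z2_5_grading] is a grading whose universal abelian group
   is Z2_5, so that [Weyl_in_Aut] does represent its Weyl group. *)
Module AlbertFacts.
Lemma Z3_ind (P : 'Z_3 -> Prop) : P 0 -> P 1 -> P 2 -> forall i, P i.
Proof.
move=> P0 P1 P2 [[|[|[|//]]] Hi].
- by rewrite (_ : Ordinal Hi = 0 :> 'Z_3) //; apply: val_inj.
- by rewrite (_ : Ordinal Hi = 1 :> 'Z_3) //; apply: val_inj.
- by rewrite (_ : Ordinal Hi = 2 :> 'Z_3) //; apply: val_inj.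
Qed.
Lemma Z3_sum (V : nmodType) (f : 'Z_3 -> V) : \sum_i f i = f 0 + f 1 + f 2.
Proof.
rewrite 3!big_ord_recl big_ord0 addr0 addrA.
by congr (f _ + f _ + f _); apply: val_inj.
Qed.
Lemma cb_sum (V : nmodType) (f : cayley_basis -> V) :
  \sum_s f s = f Be1 + f Be2 + (f (Bu 0) + f (Bu 1) + f (Bu 2))
                + (f (Bv 0) + f (Bv 1) + f (Bv 2)).
Proof.
rewrite (reindex cayley_basis_dec) /=; last first.
  by exists cayley_basis_enc => [[[]|[]]|[]].
rewrite !big_sumType /= !Z3_sum !addrA; congr (_ + _ + _ + _ + _ + _ + _).
by rewrite big_bool.
Qed.
Section C.
Variable F : fieldType.
Implicit Types x y : cayley F.

Definition sg (b c : bool) : F := if b then (if c then -1 else 1) else 0.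
Definition eqn3 (i j : 'Z_3) := eqn (val i) (val j).
Definition sh3 (i k : 'Z_3) := modn (val i + val k) 3.
Definition tab (r t s : cayley_basis) : bool * bool := match r, t, s with
  | Be1, Be1, Be1 => (true, false)
  | Be2, Be2, Be2 => (true, false)
  | Be1, Bu i, Bu k | Bu i, Be2, Bu k | Be2, Bv i, Bv k | Bv i, Be1, Bv k => (eqn3 k i, false)
  | Bu i, Bv j, Be1 => (eqn3 i j, true)
  | Bv i, Bu j, Be2 => (eqn3 i j, true)
  | Bu i, Bu j, Bv k | Bv i, Bv j, Bu k => 
      if eqn (val j) (sh3 i 1) then (eqn (val k) (sh3 i 2), false)
       else if eqn (val i) (sh3 j 1) then (eqn (val k) (sh3 j 2), true) else (false, false)
  | _, _ , _ => (false, false) end.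
Lemma tabE r t s : cayley_table F r t s = sg (tab r t s).1 (tab r t s).2.
Proof.
have D s1 t1 : (s1 == t1 :> cayley_basis) = match s1, t1 with
  Be1, Be1 | Be2, Be2 => true | Bu i, Bu j => i == j | Bv i, Bv j => i == j | _, _ => false end.
  by rewrite -(inj_eq (can_inj cayley_basis_encK)); case: s1 t1 => [||i|i] [||j|j].
have q (i j : 'Z_3) : (i == j) = eqn3 i j by [].
have q' (i j k : 'Z_3) : (i == j + k) = eqn (val i) (sh3 j k) by [].
have z (b : bool) : b%:R = sg b false by case: b.
have z' (b : bool) : - b%:R = sg b true by case: b => /=; rewrite ?oppr0.
case: r t s => [||i|i] [||j|j] [||k|k] /=; rewrite ?q' ?q; do ?case: ifP => _;
  by rewrite ?ffunE ?D ?q' ?q ?z' ?z /sg ?oppr0 //; case: ifP => _; rewrite ?oppr0.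
Qed.
Lemma mulE x y : forall s, cayley_mul x y s = match s with
 | Be1 => x Be1 * y Be1 - \sum_i x (Bu i) * y (Bv i)
 | Be2 => x Be2 * y Be2 - \sum_i x (Bv i) * y (Bu i)
 | Bu k => x Be1 * y (Bu k) + x (Bu k) * y Be2
           + x (Bv (k + 1)) * y (Bv (k + 2)) - x (Bv (k + 2)) * y (Bv (k + 1))
 | Bv k => x Be2 * y (Bv k) + x (Bv k) * y Be1
           + x (Bu (k + 1)) * y (Bu (k + 2)) - x (Bu (k + 2)) * y (Bu (k + 1))
 end.
Proof.
have e0 : (0 + 1 : 'Z_3) = 1 by apply: val_inj.
have e0' : (0 + 2 : 'Z_3) = 2 by apply: val_inj.
have e1 : (1 + 1 : 'Z_3) = 2 by apply: val_inj.
have e1' : (1 + 2 : 'Z_3) = 0 by apply: val_inj.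
have e2 : (2 + 1 : 'Z_3) = 0 by apply: val_inj.
have e2' : (2 + 2 : 'Z_3) = 1 by apply: val_inj.
have E : forall s, cayley_mul x y s = \sum_r \sum_t x r * y t * sg (tab r t s).1 (tab r t s).2.
  move=> s; rewrite /cayley_mul sum_ffunE; apply: eq_bigr => r _.
  by rewrite sum_ffunE; apply: eq_bigr => t _; rewrite -tabE ffunE.
case; [| |apply: Z3_ind|apply: Z3_ind];
  rewrite E !cb_sum ?Z3_sum ?(e0,e0',e1,e1',e2,e2').
all: do ?match goal with |- context [sg ?b ?c] =>
   let e := fresh in
   first [have e : sg b c = 0 by [] | have e : sg b c = 1 by []
         |have e : sg b c = -1 by []]; rewrite !e; clear e end.
all: ring.
Qed.
End C.

Section C.
Variable F : fieldType.
Implicit Types x y : cayley F.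
Local Notation C := (cayley F).
Local Notation "1C" := (cayley1 F).
Lemma cbE s t : (s == t :> cayley_basis) = match s, t with
  Be1, Be1 | Be2, Be2 => true | Bu i, Bu j => i == j
  | Bv i, Bv j => i == j | _, _ => false end.
Proof. by rewrite -(inj_eq (can_inj cayley_basis_encK)); case: s t => [||i|i] [||j|j]. Qed.
Lemma oneE s : 1C s = match s with Be1 | Be2 => 1 | _ => 0 end.
Proof. by rewrite !ffunE !cbE; case: s => * /=; rewrite ?addr0 ?add0r. Qed.
Lemma polarE x y : cayley_polar x y = x Be1 * y Be2 + x Be2 * y Be1
   + (\sum_i x (Bu i) * y (Bv i) + \sum_i x (Bv i) * y (Bu i)).
Proof. by rewrite /cayley_polar /cayley_norm !Z3_sum !ffunE; ring. Qed.
Lemma barE x s : cayley_bar x s = match s with Be1 => x Be2 | Be2 => x Be1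
  | _ => - x s end.
Proof.
rewrite /cayley_bar polarE !Z3_sum ffunE [X in X + _]ffunE [X in _ + X]ffunE !oneE.
have sE (a b : F) : a *: (b : F^o) = a * b by [].
by case: s => [||i|i]; rewrite sE; ring.
Qed.
Lemma barM x y : cayley_bar (cayley_mul x y) = cayley_mul (cayley_bar y) (cayley_bar x).
Proof.
apply/ffunP; case=> [||k|k]; rewrite ?(barE, mulE) ?Z3_sum ?barE; ring.
Qed.
Lemma barK x : cayley_bar (cayley_bar x) = x.
Proof. by apply/ffunP; case=> [||k|k]; rewrite !barE ?opprK. Qed.
Lemma barD x y : cayley_bar (x + y) = cayley_bar x + cayley_bar y.
Proof. by apply/ffunP; case=> [||k|k]; rewrite !(barE, ffunE) ?opprD. Qed.
Lemma barZ a x : cayley_bar (a *: x) = a *: cayley_bar x.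
Proof. by apply/ffunP; case=> [||k|k]; rewrite !(barE, ffunE) ?scalerN. Qed.
Lemma bar1 : cayley_bar 1C = 1C.
Proof. by apply/ffunP; case=> [||k|k]; rewrite !(barE, oneE) ?oppr0. Qed.
Lemma mul1C x : cayley_mul 1C x = x.
Proof. by apply/ffunP; case=> [||k|k]; rewrite !mulE ?Z3_sum !oneE; ring. Qed.
Lemma mulC1 x : cayley_mul x 1C = x.
Proof. by apply/ffunP; case=> [||k|k]; rewrite !mulE ?Z3_sum !oneE; ring. Qed.
Lemma mulDl x y z : cayley_mul (x + y) z = cayley_mul x z + cayley_mul y z.
Proof.
by rewrite /cayley_mul -big_split; apply: eq_bigr => s _ /=; rewrite -big_split /=;
  apply: eq_bigr => t _ /=; rewrite -scalerDl !ffunE mulrDl.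
Qed.
Lemma mulDr x y z : cayley_mul z (x + y) = cayley_mul z x + cayley_mul z y.
Proof.
by rewrite /cayley_mul -big_split; apply: eq_bigr => s _ /=; rewrite -big_split /=;
  apply: eq_bigr => t _ /=; rewrite -scalerDl !ffunE mulrDr.
Qed.
Lemma mulZl a x z : cayley_mul (a *: x) z = a *: cayley_mul x z.
Proof.
rewrite /cayley_mul scaler_sumr; apply: eq_bigr => s _; rewrite scaler_sumr.
by apply: eq_bigr => t _; rewrite scalerA !ffunE mulrA.
Qed.
Lemma mulZr a x z : cayley_mul z (a *: x) = a *: cayley_mul z x.
Proof.
rewrite /cayley_mul scaler_sumr; apply: eq_bigr => s _; rewrite scaler_sumr.
by apply: eq_bigr => t _; rewrite scalerA !ffunE mulrCA.
Qed.
Lemma xbary x y : cayley_mul x (cayley_bar y) + cayley_mul y (cayley_bar x)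
  = cayley_polar x y *: 1C.
Proof.
apply/ffunP => s; rewrite ffunE [RHS]ffunE oneE polarE.
have sE (a b : F) : a *: (b : F^o) = a * b by [].
by case: s => [||k|k]; rewrite sE !(mulE, barE) ?Z3_sum ?barE; ring.
Qed.
Lemma polarbar x y : cayley_polar (cayley_bar x) (cayley_bar y) = cayley_polar x y.
Proof. by rewrite !polarE !barE !Z3_sum !barE; ring. Qed.
Implicit Types X Y : albert F.
Lemma mxbar X r s : albert_mx X s r = cayley_bar (albert_mx X r s).
Proof.
rewrite !mxE.
by move: r s; apply: Z3_ind; apply: Z3_ind => /=;
  rewrite ?barK ?barZ ?bar1 //.
Qed.
Lemma jbar X Y r s : jordan_mx X Y s r = cayley_bar (jordan_mx X Y r s).
Proof.
rewrite !mxE /= barZ barD; congr (_ *: _); rewrite addrC; congr (_ + _).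
all: rewrite (big_morph _ barD (_ : _ = 0)); last by apply/ffunP; case=> *; rewrite barE !ffunE ?oppr0.
all: by apply: eq_bigr => k _; rewrite barM -!mxbar.
Qed.
Lemma jdiag X Y r : jordan_mx X Y r r =
  (2^-1 * \sum_k cayley_polar (albert_mx X r k) (albert_mx Y r k)) *: 1C.
Proof.
rewrite !mxE /= -big_split /= -scalerA scaler_suml; congr (_ *: _).
by apply: eq_bigr => k _; rewrite (mxbar Y r k) (mxbar X r k) xbary.
Qed.
Lemma albert_mulP X Y : albert_mx (albert_mul X Y) = jordan_mx X Y.
Proof.
apply/matrixP => r s; rewrite mxE /= !ffunE.
have H k : jordan_mx X Y k k Be1 *: 1C = jordan_mx X Y k k.
  by rewrite jdiag ffunE oneE; congr (_ *: _); exact: mulr1.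
case: eqP => [<-|ne]; first exact: H.
have E21 (i : 'Z_3) : i + 2 + 1 = i by move: i; apply: Z3_ind; apply: val_inj.
have E22 (i : 'Z_3) : i + 2 + 2 = i + 1 by move: i; apply: Z3_ind; apply: val_inj.
case: eqP => [->|ne']; first by rewrite -jbar E21 E22.
rewrite E21 E22; suff -> : r = s + 1 :> 'Z_3 by [].
move: r s ne ne'; apply: Z3_ind; apply: Z3_ind => // ne ne';
  by [case: ne; apply: val_inj | case: ne'; apply: val_inj | apply: val_inj].
Qed.
End C.

Definition sgi (b : bool) : int := if b then -1 else 1.
Definition wmi (b : bool * bool * bool) (s : cayley_basis) : int :=
  match s with
  | Be1 => if b.1.2 || b.2 then 0 else 1
  | Be2 => if b.1.2 || b.2 then 0 else sgi b.1.1
  | Bu k => if (val k == 1%N) && b.1.2 && ~~ b.2 then 1 else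
            if (val k == 2%N) && b.2 && ~~ b.1.2 then 1 else
            if (val k == 0%N) && b.2 && b.1.2 then sgi b.1.1 else 0
  | Bv k => if (val k == 1%N) && b.1.2 && ~~ b.2 then - sgi b.1.1 else
            if (val k == 2%N) && b.2 && ~~ b.1.2 then - sgi b.1.1 else
            if (val k == 0%N) && b.2 && b.1.2 then 1 else 0
  end.
Definition Z3s (f : 'Z_3 -> int) := f 0 + f 1 + f 2.
Definition imul (x y : cayley_basis -> int) s := match s with
 | Be1 => x Be1 * y Be1 - Z3s (fun i => x (Bu i) * y (Bv i))
 | Be2 => x Be2 * y Be2 - Z3s (fun i => x (Bv i) * y (Bu i))
 | Bu k => x Be1 * y (Bu k) + x (Bu k) * y Be2
           + x (Bv (k + 1)) * y (Bv (k + 2)) - x (Bv (k + 2)) * y (Bv (k + 1))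
 | Bv k => x Be2 * y (Bv k) + x (Bv k) * y Be1
           + x (Bu (k + 1)) * y (Bu (k + 2)) - x (Bu (k + 2)) * y (Bu (k + 1))
 end.
Definition ipolar (x y : cayley_basis -> int) := x Be1 * y Be2 + x Be2 * y Be1
   + (Z3s (fun i => x (Bu i) * y (Bv i)) + Z3s (fun i => x (Bv i) * y (Bu i))).
Definition bs := [:: false; true].
Definition b3s := [seq (p, c) | p <- [seq (a, b) | a <- bs, b <- bs], c <- bs].
Definition cbs := [:: Be1; Be2; Bu 0; Bu 1; Bu 2; Bv 0; Bv 1; Bv 2].
Definition addb3 (b c : bool * bool * bool) :=
  (b.1.1 (+) c.1.1, b.1.2 (+) c.1.2, b.2 (+) c.2).
Lemma b3sP (P : pred (bool * bool * bool)) : all P b3s -> forall b, P b.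
Proof. by move=> /allP H [[[] []] []]; apply: H. Qed.
Lemma cbsP (P : cayley_basis -> bool) : all P cbs -> forall b, P b.
Proof.
move=> /=; do 8 case/andP => ?; move=> _.
by case=> [||i|i] //; move: i; apply: Z3_ind.
Qed.
Definition eqi (x y : cayley_basis -> int) := all (fun s => x s == y s) cbs.
Lemma imulb b c :
  eqi (imul (wmi b) (wmi c)) (wmi (addb3 b c)) ||
  eqi (imul (wmi b) (wmi c)) (fun s => - wmi (addb3 b c) s).
Proof.
apply: (@b3sP (fun c => _) _ c).
apply: (@b3sP (fun b => all (fun c => eqi (imul (wmi b) (wmi c)) (wmi (addb3 b c)) ||
  eqi (imul (wmi b) (wmi c)) (fun s => - wmi (addb3 b c) s)) b3s) _ b).
by vm_compute.
Qed.
Lemma ipolarb b c :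
  if b == c then (ipolar (wmi b) (wmi c) == 2) || (ipolar (wmi b) (wmi c) == -2)
  else ipolar (wmi b) (wmi c) == 0.
Proof.
apply: (@b3sP (fun c => _) _ c).
apply: (@b3sP (fun b => all (fun c => if b == c then (ipolar (wmi b) (wmi c) == 2) || (ipolar (wmi b) (wmi c) == -2)
  else ipolar (wmi b) (wmi c) == 0) b3s) _ b).
by vm_compute.
Qed.

Section C.
Variable F : fieldType.
Local Notation C := (cayley F).
Definition emb (x : cayley_basis -> int) : C := [ffun s => (x s)%:~R].
Lemma embM x y : cayley_mul (emb x) (emb y) = emb (imul x y).
Proof.
apply/ffunP => -[||k|k]; rewrite mulE ?Z3_sum !ffunE /= /Z3s;
 by rewrite ?(rmorphB, rmorphD, rmorphM).
Qed.
Lemma embP x y : cayley_polar (emb x) (emb y) = (ipolar x y)%:~R.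
Proof. by rewrite polarE !Z3_sum !ffunE !(rmorphD, rmorphM). Qed.
Lemma eqiP x y : eqi x y -> emb x = emb y.
Proof. by move/cbsP => e; apply/ffunP => s; rewrite !ffunE (eqP (e s)). Qed.
Lemma embN x : emb (fun s => - x s) = - emb x.
Proof. by apply/ffunP => s; rewrite !ffunE rmorphN. Qed.

Definition tb (t : 'rV['F_2]_3) := (t 0 0 != 0, t 0 1 != 0, t 0 2 != 0).
Lemma tbD s t : tb (s + t) = addb3 (tb s) (tb t).
Proof.
rewrite /tb /addb3 !mxE; congr (_, _, _);
 [move: (s 0 0) (t 0 0) | move: (s 0 1) (t 0 1)|move: (s 0 2) (t 0 2)];
by case=> [[|[|//]] ?] [[|[|//]] ?].
Qed.
Lemma tb_inj : injective tb.
Proof.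
move=> s t [] e0 e1 e2; apply/rowP => i.
have K (a b : 'F_2) : (a != 0) = (b != 0) -> a = b.
  by move: a b; case=> [[|[|//]] ?] [[|[|//]] ?] // _; apply/eqP.
have P (j : 'I_3) : val i = val j -> s 0 j = t 0 j -> s 0 i = t 0 i.
  by move/val_inj ->.
case: i P => [[|[|[|//]]] Hi] P; 
 [apply: (P 0)|apply: (P 1)|apply: (P 2)] => //; exact: K.
Qed.
Lemma w_monE t : w_mon F t = emb (wmi (tb t)).
Proof.
have i1 : cayley1 F = emb (wmi (false, false, false)).
  by apply/ffunP => -[||k|k]; rewrite oneE ffunE //= ?andbF.
have e3 : w1 F = emb (wmi (true, false, false)).
  by apply/ffunP => -[||k|k]; rewrite !ffunE !cbE /= ?andbF ?subr0 ?sub0r.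
have e4 : w2 F = emb (wmi (false, true, false)).
  apply/ffunP => -[||k|k]; rewrite !ffunE !cbE /= ?subr0 //.
    by move: k; apply: Z3_ind; rewrite /= ?subr0.
  by move: k; apply: Z3_ind; rewrite /= ?sub0r ?oppr0.
have e5 : w3 F = emb (wmi (false, false, true)).
  apply/ffunP => -[||k|k]; rewrite !ffunE !cbE /= ?subr0 //.
    by move: k; apply: Z3_ind; rewrite /= ?subr0.
  by move: k; apply: Z3_ind; rewrite /= ?sub0r ?oppr0.
rewrite /w_mon /w_pow /tb.
case: (t 0 0 == 0); case: (t 0 1 == 0); case: (t 0 2 == 0);
 rewrite ?(i1, e3, e4, e5) !embM /=; apply: eqiP; by vm_compute.
Qed.
Lemma w_monM s t : cayley_mul (w_mon F s) (w_mon F t) \in <[w_mon F (s + t)]>%VS.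
Proof.
rewrite !w_monE embM tbD; case/orP: (imulb (tb s) (tb t)) => /eqiP ->.
  exact: memv_line.
by rewrite embN rpredN memv_line.
Qed.
Lemma w_monP s t : s != t -> cayley_polar (w_mon F s) (w_mon F t) = 0.
Proof.
rewrite -(inj_eq tb_inj) !w_monE embP => /negPf ne.
by move: (ipolarb (tb s) (tb t)); rewrite ne => /eqP ->.
Qed.
Lemma w_monPn t : (2 : F) != 0 -> cayley_polar (w_mon F t) (w_mon F t) != 0.
Proof.
rewrite !w_monE embP => n2; move: (ipolarb (tb t) (tb t)); rewrite eqxx.
by case/orP => /eqP ->; rewrite ?rmorphN ?oppr_eq0.
Qed.
Lemma w_mon0 t : w_mon F t != 0.
Proof.
rewrite w_monE; apply/eqP => /ffunP H.
case: (tb t) H => [[[] []] []] H;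
 do [by have /eqP := H Be1; rewrite !ffunE /= oner_eq0
    |by have /eqP := H (Bu 1); rewrite !ffunE /= oner_eq0
    |by have /eqP := H (Bu 2); rewrite !ffunE /= oner_eq0
    |by have /eqP := H (Bv 0); rewrite !ffunE /= oner_eq0].
Qed.
Lemma w_mon_bar t : cayley_bar (w_mon F t) \in <[w_mon F t]>%VS.
Proof.
rewrite w_monE.
have : cayley_bar (emb (wmi (tb t))) = emb (wmi (tb t)) \/
  cayley_bar (emb (wmi (tb t))) = - emb (wmi (tb t)).
  case: (tb t) => [[[] []] []]; [right|right|right|right|right|right|right|left];
  apply/ffunP => -[||k|k]; rewrite barE !ffunE /= ?andbF ?oppr0 ?opprK //.
by case=> ->; rewrite ?rpredN memv_line.
Qed.
Lemma cayley_span : (2 : F) != 0 -> (\sum_t <[w_mon F t]>)%VS = fullv.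
Proof.
move=> n2; apply/eqP; rewrite eqEsubv subvf /=; apply/subvP => x _.
have mt b : emb (wmi b) \in (\sum_t <[w_mon F t]>)%VS.
  case: b => [[b1 b2] b3].
  pose t : 'rV['F_2]_3 := \row_j (nth 0 [:: (b1 : nat)%:R; (b2 : nat)%:R; (b3 : nat)%:R] j).
  have -> : emb (wmi (b1, b2, b3)) = w_mon F t.
    rewrite w_monE; congr (emb (wmi (_, _, _))); rewrite mxE /=.
    by case: (b1). by case: (b2). by case: (b3).
  by apply: subvP (memv_line _); apply: (sumv_sup t).
have cbm s : cb F s \in (\sum_t <[w_mon F t]>)%VS.
  pose dl r : int := if cayley_basis_enc r == cayley_basis_enc s then 1 else 0.
  have es : cb F s = emb dl.
    apply/ffunP => r; rewrite !ffunE -(inj_eq (can_inj cayley_basis_encK)) /dl.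
    by case: ifP.
  suff [b [c [m e]]] : exists b c (m : int),
      eqi (fun r => dl r + dl r) (fun r => wmi b r + m * wmi c r).
    have e2 : 2 *: cb F s = emb (wmi b) + m%:~R *: emb (wmi c).
      rewrite scaler_nat mulr2n es.
      have -> : emb dl + emb dl = emb (fun r => dl r + dl r).
        by apply/ffunP => r; rewrite !ffunE rmorphD.
      rewrite (eqiP e); apply/ffunP => r; rewrite !ffunE rmorphD rmorphM.
      by [].
    rewrite -[cb F s]scale1r -(mulVf n2) -scalerA e2.
    by rewrite memvZ // memvD ?memvZ ?mt.
  rewrite /dl; clear; case: s => [||k|k].
  - by exists (false,false,false), (true,false,false), 1; vm_compute.
  - by exists (false,false,false), (true,false,false), (-1); vm_compute.
  - move: k; apply: Z3_ind.
    + by exists (false,true,true), (true,true,true), (-1); vm_compute.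
    + by exists (true,true,false), (false,true,false), 1; vm_compute.
    + by exists (true,false,true), (false,false,true), 1; vm_compute.
  - move: k; apply: Z3_ind.
    + by exists (false,true,true), (true,true,true), (1); vm_compute.
    + by exists (true,true,false), (false,true,false), (-1); vm_compute.
    + by exists (true,false,true), (false,false,true), (-1); vm_compute.
have -> : x = \sum_s x s *: cb F s.
  apply/ffunP => r; rewrite sum_ffunE (bigD1 r) //= big1 ?addr0 => [|s sr].
    by rewrite !ffunE eqxx; apply/esym/mulr1.
  by rewrite !ffunE eq_sym (negPf sr); apply: mulr0.
by apply: memv_suml => s _; rewrite memvZ ?cbm.
Qed.
End C.
Section C.
Variable F : fieldType.
Hypothesis n2 : (2 : F) != 0.
Local Notation C := (cayley F).
Local Notation A := (albert F).
Implicit Types X Y : A.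
Lemma cayley_polarZ (a b : F) (x y : C) :
  cayley_polar (a *: x) (b *: y) = a * b * cayley_polar x y.
Proof. by rewrite !polarE !Z3_sum !ffunE /GRing.scale /=; ring. Qed.
Lemma albert_mul1 X Y i : (albert_mul X Y).1 i =
  X.1 i * Y.1 i + 2^-1 * (cayley_polar (X.2 (i + 1)) (Y.2 (i + 1))
                          + cayley_polar (X.2 (i + 2)) (Y.2 (i + 2))).
Proof.
rewrite ffunE jdiag ffunE oneE Z3_sum.
have p1 (a b : F) : cayley_polar (a *: cayley1 F) (b *: cayley1 F) = 2 * a * b.
  by rewrite cayley_polarZ polarE !Z3_sum !oneE; ring.
rewrite [_ *: 1](mulr1 _).
have -> : X.1 i * Y.1 i = 2^-1 * (2 * X.1 i * Y.1 i) by rewrite -mulrA mulKf.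
rewrite -mulrDr; congr (_ * _); rewrite !mxE.
have e0 : (0 + 1 : 'Z_3) = 1 by apply: val_inj.
have e0' : (0 + 2 : 'Z_3) = 2 by apply: val_inj.
have e1 : (1 + 1 : 'Z_3) = 2 by apply: val_inj.
have e1' : (1 + 2 : 'Z_3) = 0 by apply: val_inj.
have e2 : (2 + 1 : 'Z_3) = 0 by apply: val_inj.
have e2' : (2 + 2 : 'Z_3) = 1 by apply: val_inj.
move: i; apply: Z3_ind; rewrite !(e0, e0', e1, e1', e2, e2') /= p1
  ?polarbar; ring.
Qed.
Lemma albert_mul2 X Y i : (albert_mul X Y).2 i =
  2^-1 *: ((X.1 (i + 1) + X.1 (i + 2)) *: Y.2 i
          + (Y.1 (i + 1) + Y.1 (i + 2)) *: X.2 i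
          + cayley_mul (cayley_bar (X.2 (i + 1))) (cayley_bar (Y.2 (i + 2)))
          + cayley_mul (cayley_bar (Y.2 (i + 1))) (cayley_bar (X.2 (i + 2)))).
Proof.
rewrite ffunE mxE; congr (_ *: _); rewrite !mxE !Z3_sum !mxE.
have e0 : (0 + 1 : 'Z_3) = 1 by apply: val_inj.
have e0' : (0 + 2 : 'Z_3) = 2 by apply: val_inj.
have e1 : (1 + 1 : 'Z_3) = 2 by apply: val_inj.
have e1' : (1 + 2 : 'Z_3) = 0 by apply: val_inj.
have e2 : (2 + 1 : 'Z_3) = 0 by apply: val_inj.
have e2' : (2 + 2 : 'Z_3) = 1 by apply: val_inj.
have L (a : F) x : cayley_mul (a *: cayley1 F) x = a *: x by rewrite mulZl mul1C.
have R (a : F) x : cayley_mul x (a *: cayley1 F) = a *: x by rewrite mulZr mulC1.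
move: i; apply: Z3_ind; rewrite !(e0, e0', e1, e1', e2, e2') /= !L !R !scalerDl;
  by apply/ffunP => s; rewrite !ffunE; ring.
Qed.
Lemma iota_lin i : linear (@albert_iota F i).
Proof.
move=> a x y; congr pair; first by rewrite [RHS]/= [a *: 0]scaler0 addr0.
apply/ffunP => j; rewrite !ffunE; case: ifP => _; last by rewrite scaler0 addr0.
by rewrite scalerDr !scalerA mulrC.
Qed.
HB.instance Definition _ i := GRing.isLinear.Build F C A _ (@albert_iota F i) (iota_lin i).
Local Notation Gam := (@Z2_5_grading F).
Local Notation L := (@lsubmx 'F_2 1 2 3).
Local Notation Rs := (@rsubmx 'F_2 1 2 3).
Lemma Rs_iota i : Rs (deg_iota i) = 0.
Proof.
by rewrite /deg_iota; do 2?case: ifP => _; rewrite ?linearD /= !row_mxKr ?addr0.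
Qed.
Lemma deg_iotaE i g t : (deg_iota i + deg_T t == g) = (L g == L (deg_iota i)) && (Rs g == t).
Proof.
rewrite -[deg_iota i in LHS](@hsubmxK _ 1 2 3) Rs_iota /deg_T.
rewrite (@add_row_mx _ 1 2 3) addr0 add0r -[g in LHS](@hsubmxK _ 1 2 3).
apply/eqP/andP => [/eq_row_mx [-> ->]//|[/eqP -> /eqP ->] //].
Qed.
Lemma L_iota_inj : injective (fun i => L (deg_iota i)).
Proof.
apply: Z3_ind; apply: Z3_ind => //; rewrite /deg_iota /= ?linearD /= !row_mxKl => /rowP H;
 (have := H 0; rewrite !mxE => /eqP; have := H 1; rewrite !mxE => /eqP //).
Qed.
Lemma L_iota0 i : L (deg_iota i) != 0.
Proof.
apply/eqP; move: i; apply: Z3_ind; rewrite /deg_iota /= ?linearD /= !row_mxKl => /rowP H;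
 (have := H 0; rewrite !mxE => /eqP; have := H 1; rewrite !mxE => /eqP //).
Qed.
Lemma L_iota2 i : L (deg_iota (i + 1)) + L (deg_iota (i + 2)) = L (deg_iota i).
Proof.
move: i; apply: Z3_ind; rewrite /deg_iota /= ?linearD /= !row_mxKl;
 apply/rowP => -[[|[|//]] ?]; rewrite !mxE; apply/eqP => //.
Qed.
Lemma XE X : X = \sum_i X.1 i *: albertE F i + \sum_i albert_iota i (2^-1 *: X.2 i).
Proof.
have s1 (I : finType) (f : I -> A) : (\sum_i f i).1 = \sum_i (f i).1 by apply: (big_morph fst).
have s2 (I : finType) (f : I -> A) : (\sum_i f i).2 = \sum_i (f i).2 by apply: (big_morph snd).
rewrite [LHS]surjective_pairing; congr pair.
  rewrite /= s1 s1 [X in _ + X]big1 // addr0.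
  apply/ffunP => r; rewrite sum_ffunE (bigD1 r) //= big1 ?addr0 => [|s sr].
    by rewrite !ffunE eqxx; apply/esym/mulr1.
  by rewrite !ffunE eq_sym (negPf sr); apply: mulr0.
rewrite /= s2 s2 [X in X + _]big1 ?add0r => [|i _]; last exact: scaler0.
apply/ffunP => r; rewrite sum_ffunE (bigD1 r) //= big1 ?addr0 => [|s sr].
  by rewrite !ffunE eqxx scalerA mulfV // scale1r.
by rewrite !ffunE eq_sym (negPf sr).
Qed.
Lemma GamP g X : X \in Gam g <-> (g != 0 -> X.1 = 0) /\
  forall i, X.2 i \in (if L g == L (deg_iota i) then <[w_mon F (Rs g)]> else 0)%VS.
Proof.
split=> [/memv_addP [u hu [v hv ->]]|[h1 h2]].
  have u2 : u.2 = 0.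
    move: hu; case: ifP => _; last by rewrite memv0 => /eqP ->.
    move=> /memv_sumP [f hf ->]; rewrite (big_morph snd (id1 := 0) (op1 := +%R)) // big1 // => i _.
    by have /vlineP [k ->] := hf i isT; exact: scaler0.
  move: hv => /memv_sumP [f hf ->].
  have hf' i : exists2 y : C, f i = albert_iota i y & y \in (if L g == L (deg_iota i) then <[w_mon F (Rs g)]> else 0)%VS.
    have := hf i isT; under eq_bigl do rewrite deg_iotaE.
    case: eqP => _ /=; last first.
      by rewrite big_pred0_eq memv0 => /eqP ->; exists 0; rewrite ?linear0 ?mem0v.
    rewrite (eq_bigl (fun t => t == Rs g)) => [|t]; last by rewrite eq_sym.
    by rewrite big_pred1_eq => /memv_imgP [y hy ->]; exists y => //; rewrite lfunE.
  split=> [g0|i].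
    have -> : u = 0 by move: hu; rewrite (negPf g0) memv0 => /eqP.
    rewrite add0r (big_morph fst (id1 := 0) (op1 := +%R)) // big1 // => i _.
    by have [y -> _] := hf' i.
  rewrite [(_ + _).2]/= u2 add0r (big_morph snd (id1 := 0) (op1 := +%R)) // sum_ffunE.
  rewrite (bigD1 i) //= big1 ?addr0 => [|j ji].
    by have [y -> hy] := hf' i; rewrite ffunE eqxx memvZ.
  by have [y -> _] := hf' j; rewrite ffunE eq_sym (negPf ji).
rewrite (XE X) memv_add //.
  have [_|/h1 ->] := eqVneq g 0.
    by apply: memv_sumr => i _; rewrite memvZ ?memv_line.
  by rewrite big1 ?mem0v // => i _; rewrite ffunE scale0r.
apply: memv_sumr => i _; under eq_bigl do rewrite deg_iotaE.
have := h2 i; case: eqP => _ /=; last first.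
  by rewrite big_pred0_eq !memv0 => /eqP ->; rewrite !linear0.
rewrite (eq_bigl (fun t => t == Rs g)) => [|t]; last by rewrite eq_sym.
rewrite big_pred1_eq => h.
by rewrite -[albert_iota _ _]/(albert_iota i _) -(lfunE (@albert_iota F i)) memv_img // memvZ.
Qed.
Lemma F2D (x : Z2_5) : x + x = 0.
Proof. by apply/rowP => i; rewrite !mxE; case: (x 0 i) => [[|[|//]] ?]; apply/eqP. Qed.
Lemma addE (x y : Z2_5) : (x + y == 0) = (x == y).
Proof. by rewrite -(inj_eq (addIr y)) -addrA F2D addr0 add0r. Qed.
Lemma GamM g h X Y : X \in Gam g -> Y \in Gam h -> albert_mul X Y \in Gam (g + h).
Proof.
move=> /GamP [X1 X2] /GamP [Y1 Y2]; apply/GamP; split=> [gh|i].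
  apply/ffunP => i; rewrite albert_mul1 ffunE.
  have -> : X.1 i * Y.1 i = 0.
    have [g0|/X1 ->] := eqVneq g 0; last by rewrite ffunE mul0r.
    by rewrite Y1 ?ffunE ?mulr0 //; apply: contraNneq gh => ->; rewrite g0 addr0.
  have P j : cayley_polar (X.2 j) (Y.2 j) = 0.
    have z0 y : cayley_polar (0 : C) y = 0.
      by rewrite -(scale0r (0 : C)) -[y]scale1r cayley_polarZ !mul0r.
    have z0' y : cayley_polar y (0 : C) = 0.
      by rewrite -(scale0r (0 : C)) -[y]scale1r cayley_polarZ mulr0 mul0r.
    move: (X2 j) (Y2 j); case: eqP => [eg|_]; last by rewrite memv0 => /eqP ->; rewrite z0.
    case: eqP => [eh|_]; last by move=> _; rewrite memv0 => /eqP ->; rewrite z0'.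
    move=> /vlineP [k ->] /vlineP [l ->]; rewrite cayley_polarZ w_monP ?mulr0 //.
    apply: contraNneq gh => er; rewrite addE; apply/eqP.
    by rewrite -[g](@hsubmxK _ 1 2 3) -[h](@hsubmxK _ 1 2 3) eg eh er.
  by rewrite !P addr0 mulr0 addr0.
rewrite albert_mul2 memvZ // !memvD //.
- have [g0|/X1 ->] := eqVneq g 0; last by rewrite !ffunE addr0 scale0r mem0v.
  by rewrite g0 add0r memvZ.
- have [h0|/Y1 ->] := eqVneq h 0; last by rewrite !ffunE addr0 scale0r mem0v.
  by rewrite h0 addr0 memvZ.
- have zb : cayley_bar (0 : C) = 0 by rewrite -(scale0r (0 : C)) barZ !scale0r.
  have zl y : cayley_mul (0 : C) y = 0 by rewrite -(scale0r (0 : C)) mulZl !scale0r.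
  have zr y : cayley_mul y (0 : C) = 0 by rewrite -(scale0r (0 : C)) mulZr !scale0r.
  have wb t k : exists l, cayley_bar (k *: w_mon F t) = l *: w_mon F t.
    have /vlineP [l e] := w_mon_bar F t.
    by exists (k * l); rewrite barZ e scalerA.
  move: (X2 (i + 1)) (Y2 (i + 2)); case: eqP => [eg|_]; last by rewrite memv0 => /eqP -> _; rewrite zb zl mem0v.
  case: eqP => [eh|_]; last by move=> _; rewrite memv0 => /eqP ->; rewrite zb zr mem0v.
  rewrite (linearD L) (linearD Rs) /= eg eh L_iota2 eqxx.
  move=> /vlineP [k ->] /vlineP [l ->].
  have [k' ->] := wb (Rs g) k; have [l' ->] := wb (Rs h) l.
  by rewrite mulZl mulZr !memvZ ?w_monM.
- have zb : cayley_bar (0 : C) = 0 by rewrite -(scale0r (0 : C)) barZ !scale0r.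
  have zl y : cayley_mul (0 : C) y = 0 by rewrite -(scale0r (0 : C)) mulZl !scale0r.
  have zr y : cayley_mul y (0 : C) = 0 by rewrite -(scale0r (0 : C)) mulZr !scale0r.
  have wb t k : exists l, cayley_bar (k *: w_mon F t) = l *: w_mon F t.
    have /vlineP [l e] := w_mon_bar F t.
    by exists (k * l); rewrite barZ e scalerA.
  move: (Y2 (i + 1)) (X2 (i + 2)); case: eqP => [eg|_]; last by rewrite memv0 => /eqP -> _; rewrite zb zl mem0v.
  case: eqP => [eh|_]; last by move=> _; rewrite memv0 => /eqP ->; rewrite zb zr mem0v.
  rewrite (addrC g h) (linearD L) (linearD Rs) /= eg eh L_iota2 eqxx.
  move=> /vlineP [k ->] /vlineP [l ->].
  have [k' ->] := wb (Rs h) k; have [l' ->] := wb (Rs g) l.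
  by rewrite mulZl mulZr !memvZ ?w_monM.
Qed.
End C.
Section C.
Variable F : fieldType.
Hypothesis n2 : (2 : F) != 0.
Local Notation C := (cayley F).
Local Notation A := (albert F).
Local Notation Gam := (@Z2_5_grading F).
Local Notation L := (@lsubmx 'F_2 1 2 3).
Local Notation Rs := (@rsubmx 'F_2 1 2 3).
Lemma LdT i t : L (deg_iota i + deg_T t) = L (deg_iota i).
Proof. by rewrite linearD /= row_mxKl addr0. Qed.
Lemma RdT i t : Rs (deg_iota i + deg_T t) = t.
Proof. by rewrite linearD /= Rs_iota row_mxKr add0r. Qed.
Lemma EGam i : albertE F i \in Gam 0.
Proof. by apply/(GamP n2); split; [rewrite eqxx|move=> j; rewrite ffunE mem0v]. Qed.
Lemma iGam i t k : albert_iota i (k *: w_mon F t) \in Gam (deg_iota i + deg_T t).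
Proof.
apply/(GamP n2); split=> // j; rewrite ffunE RdT LdT.
by case: eqP => [->|_]; rewrite ?mem0v // eqxx memvZ // memvZ // memv_line.
Qed.
Lemma Gam_full : (\sum_g Gam g)%VS = fullv.
Proof.
apply/eqP; rewrite eqEsubv subvf /=; apply/subvP => X _; rewrite (XE n2 X).
apply: memvD; apply: memv_suml => i _.
  rewrite memvZ //; apply: subvP (EGam i); exact: (sumv_sup 0).
have : 2^-1 *: X.2 i \in (\sum_t <[w_mon F t]>)%VS by rewrite cayley_span ?memvf.
move=> /memv_sumP [f hf ->]; rewrite linear_sum; apply: memv_suml => t _.
have /vlineP [k ->] := hf t isT.
apply: subvP (iGam i t k); exact: (sumv_sup (deg_iota i + deg_T t)).
Qed.
Lemma Gam_direct : directv (\sum_g Gam g)%VS.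
Proof.
apply/directvP; rewrite /= Gam_full; apply/eqP; rewrite eqn_leq -{1}Gam_full dimv_leq_sum /=.
have le g : (\dim (Gam g) <= (g == 0)%R * 3 + \sum_i \sum_(t | (deg_iota i + deg_T t == g)%R) 1)%N.
  apply: leq_trans (dimv_add_leqif _ _) _; apply: leq_add.
    case: eqP => _; last by rewrite dimv0.
    apply: leq_trans (dimv_leq_sum _ _ _) _.
    apply: (@leq_trans (\sum_(i : 'Z_3) 1)%N); last by rewrite sum1_card card_ord.
    by apply: leq_sum => i _; rewrite dim_vline leq_b1.
  apply: leq_trans (dimv_leq_sum _ _ _) _; apply: leq_sum => i _.
  apply: leq_trans (dimv_leq_sum _ _ _) _; apply: leq_sum => t _.
  apply: (leq_trans (leq_trans (leq_addl _ _) (eq_leq (limg_ker_dim _ _)))).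
  by rewrite dim_vline leq_b1.
apply: leq_trans (leq_sum _ (fun g _ => le g)) _.
rewrite big_split /= -big_distrl /= (bigD1 0) //= big1 => [|g /negPf -> //].
rewrite exchange_big /=.
under [X in (_ + X <= _)%N]eq_bigr => i _.
  rewrite (exchange_big_dep xpredT) //=.
  rewrite (eq_bigr (fun=> 1%N)) => [|t _]; last first.
    by rewrite (big_pred1 (deg_iota i + deg_T t)) // => g /=; rewrite eq_sym.
  over.
have -> : \dim {:A} = (3 * 1 + 3 * dim (cayley F))%N.
  have dI (V : vectType F) : dim ({ffun 'Z_3 -> V} : vectType F) = (3 * dim V)%N.
    by rewrite {1}/dim /= card_ord.
  rewrite dimvf -[1%N]/(dim (F^o : vectType F)) -!dI; reflexivity.
rewrite !sum_nat_const.
have -> : #|(xpredT : pred 'Z_3)| = 3 by rewrite -[RHS](card_ord 3); apply: eq_card.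
have -> : #|(xpredT : pred 'rV['F_2]_3)| = 8.
  have -> : #|(xpredT : pred 'rV['F_2]_3)| = #|{:'rV['F_2]_3}| by apply: eq_card.
  by rewrite card_mx card_ord.
have d1 : dim (F^o : vectType F) = 1%N by [].
have -> : dim (cayley F) = 8%N.
  by rewrite /dim /= -[LHS]muln1 -sum1_card cb_sum.
by rewrite eqxx.
Qed.
Lemma Gam_grading : is_grading (@albert_mul F) Gam.
Proof.
split; [exact: Gam_full | exact: Gam_direct|].
by move=> g h x y; apply: GamM.
Qed.
Lemma SuppE i t : deg_iota i + deg_T t \in Supp Gam.
Proof.
rewrite inE; apply: contraTneq (iGam i t 1) => ->; rewrite memv0 scale1r.
apply/eqP => -[] /ffunP /(_ i); rewrite !ffunE eqxx => /eqP.
by rewrite scaler_eq0 (negPf n2) (negPf (w_mon0 _ _)).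
Qed.
Lemma Supp0 : 0 \in Supp Gam.
Proof.
rewrite inE; apply: contraTneq (EGam 0) => ->; rewrite memv0.
by apply/eqP => -[] /ffunP /(_ 0); rewrite !ffunE eqxx => /eqP; rewrite oner_eq0.
Qed.
Lemma SuppP g : g \in Supp Gam -> g = 0 \/ exists i t, g = deg_iota i + deg_T t.
Proof.
rewrite inE => g0; apply: contrapT => /not_orP [/eqP gn0 H].
case/negP: g0; rewrite -subv0; apply/subvP => X /(GamP n2) [/(_ gn0) X1 X2].
rewrite memv0; apply/eqP; rewrite [X]surjective_pairing X1; congr pair.
apply/ffunP => i; rewrite ffunE; have := X2 i.
case: eqP => [e|_]; last by rewrite memv0 => /eqP.
case: H; exists i, (Rs g); apply/esym/eqP.
by rewrite deg_iotaE e !eqxx.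
Qed.

Lemma w_monM' s t : exists2 c : F, c != 0 & cayley_mul (w_mon F s) (w_mon F t) = c *: w_mon F (s + t).
Proof.
rewrite !w_monE embM tbD; case/orP: (imulb (tb s) (tb t)) => /eqiP ->.
  by exists 1; rewrite ?oner_eq0 ?scale1r.
by exists (-1); rewrite ?oppr_eq0 ?oner_eq0 // embN scaleN1r.
Qed.
Lemma w_mon_bar' t : exists2 c : F, c != 0 & cayley_bar (w_mon F t) = c *: w_mon F t.
Proof.
have /vlineP [c e] := w_mon_bar F t; exists c => //.
apply: contraNneq (w_mon0 F t) => c0; rewrite -(barK (w_mon F t)) e c0 scale0r.
by rewrite -(scale0r (0 : C)) barZ !scale0r.
Qed.
Lemma zb : cayley_bar (0 : C) = 0. Proof. by rewrite -(scale0r (0 : C)) barZ !scale0r. Qed.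
Lemma zl y : cayley_mul (0 : C) y = 0. Proof. by rewrite -(scale0r (0 : C)) mulZl !scale0r. Qed.
Lemma z0 y : cayley_polar (0 : C) y = 0.
Proof. by rewrite -(scale0r (0 : C)) -[y]scale1r cayley_polarZ !mul0r. Qed.
Lemma iGam1 i t : albert_iota i (w_mon F t) \in Gam (deg_iota i + deg_T t).
Proof. by rewrite -[w_mon F t]scale1r iGam. Qed.
Lemma albert_universal : is_universal (@albert_mul F) Gam.
Proof.
move=> H d [_ dM].
have d0 : d 0 = 0.
  have nz : albert_mul (albertE F 0) (albertE F 0) != 0.
    apply/eqP => /(congr1 (fun X : A => X.1 0)); rewrite albert_mul1 // !ffunE eqxx !z0.
    by rewrite addr0 mulr0 addr0 mulr1 => /eqP; rewrite oner_eq0.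
  have := dM _ _ Supp0 Supp0 _ _ (EGam 0) (EGam 0) nz.
  by rewrite addr0 => /(congr1 (fun x => x - d 0)); rewrite addrK subrr.
pose D i t := d (deg_iota i + deg_T t).
have D2 i t : D i t + D i t = 0.
  have nz : albert_mul (albert_iota i (w_mon F t)) (albert_iota i (w_mon F t)) != 0.
    apply/eqP => /(congr1 (fun X : A => X.1 (i + 1))); rewrite albert_mul1 // !ffunE.
    have -> : i + 1 + 2 = i by move: i; apply: Z3_ind; apply: val_inj.
    have -> : (i + 1 + 1 == i) = false by move: i; apply: Z3_ind.
    rewrite eqxx mul0r z0 !add0r cayley_polarZ => /eqP.
    by rewrite !mulf_eq0 invr_eq0 (negPf n2) (negPf (w_monPn _ _)).
  have := dM _ _ (SuppE i t) (SuppE i t) _ _ (iGam1 i t) (iGam1 i t) nz.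
  by rewrite F2D d0.
have D12 s t : D 0 (s + t) = D 1 s + D 2 t.
  have nz : albert_mul (albert_iota 1 (w_mon F s)) (albert_iota 2 (w_mon F t)) != 0.
    apply/eqP => /(congr1 (fun X : A => X.2 0)); rewrite albert_mul2 // !ffunE /=.
    rewrite !add0r /= zb zl !scaler0 !addr0 add0r !barZ mulZl mulZr.
    have [c c0 ->] := w_mon_bar' s; have [c' c0' ->] := w_mon_bar' t.
    rewrite mulZl mulZr; have [k k0 ->] := w_monM' s t.
    move/eqP; rewrite !scaler_eq0 invr_eq0 (negPf n2) (negPf c0) (negPf c0') (negPf k0).
    by rewrite (negPf (w_mon0 _ _)).
  have := dM _ _ (SuppE 1 s) (SuppE 2 t) _ _ (iGam1 1 s) (iGam1 2 t) nz.
  rewrite addrACA /D => <-; congr d; rewrite /deg_T /deg_iota /= /deg_a /deg_b.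
  by rewrite !(@add_row_mx _ 1 2 3) !addr0.
pose al := D 1 0; pose be := D 2 0; pose ph t := D 1 t + al.
have H2 (x y : H) : x + x = 0 -> y + x + x = y by move=> e; rewrite -addrA e addr0.
have phD s t : ph (s + t) = ph s + ph t.
  have e1 u : D 0 u = D 1 u + be by rewrite -D12 addr0.
  have e2 u : D 0 u = al + D 2 u by rewrite -D12 add0r.
  have e3 : D 1 (s + t) = D 1 s + D 2 t + be by rewrite -D12 e1 H2 // D2.
  have e4 : D 2 t = al + (D 1 t + be) by rewrite -e1 e2 addrA D2 add0r.
  have e5 : D 1 (s + t) = D 1 s + D 1 t + al.
    by rewrite e3 e4 -!addrA D2 addr0 (addrC al).
  by rewrite /ph e5 -addrA [RHS]addrACA.
have ph2 t : ph t + ph t = 0 by rewrite /ph addrACA D2 /al D2 addr0.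
have ph0 : ph 0 = 0 by rewrite /ph D2.
pose bt (b : 'F_2) (x : H) : H := if b == 0 then 0 else x.
have btD b c x : x + x = 0 -> bt (b + c) x = bt b x + bt c x.
  by move=> xx; rewrite /bt; case: b c => [[|[|//]] ?] [[|[|//]] ?] /=; rewrite ?addr0 ?add0r.
pose f (g : Z2_5) := bt (L g 0 0) al + bt (L g 0 1) be + ph (Rs g).
have fD g h : f (g + h) = f g + f h.
  have LD j : L (g + h) 0 j = L g 0 j + L h 0 j by rewrite linearD mxE.
  rewrite /f !LD (linearD Rs) /= phD.
  rewrite !btD; [|exact: D2|exact: D2].
  by rewrite (addrACA (bt (L g 0 0) al)) [RHS]addrACA.
have f0 : f 0 = 0 by apply: (addrI (f 0)); rewrite -fD !addr0.
have zf (k : Z2_5 -> H) : zmod_morphism k -> forall g h, k (g + h) = k g + k h.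
  move=> kM g h; have k0 : k 0 = 0 by rewrite -{1}(subrr (0 : Z2_5)) kM subrr.
  have kN : k (- h) = - k h by have := kM 0 h; rewrite !sub0r k0 sub0r.
  by rewrite -{1}(opprK h) kM kN opprK.
have fM : zmod_morphism f.
  move=> g h; apply: (addIr (f h)); rewrite -fD subrK.
  by rewrite addrNK.
have fd i t : f (deg_iota i + deg_T t) = D i t.
  rewrite /f LdT RdT.
  have D0t : D 0 t = D 1 t + be by rewrite -D12 addr0.
  have D2t : D 2 t = al + (D 1 t + be).
    by rewrite -D0t -[in D 0 t](add0r t) D12 addrA D2 add0r.
  have al2 : al + al = 0 by apply: D2.
  move: i; apply: Z3_ind; rewrite /deg_iota /= ?linearD /= !row_mxKl !mxE /bt /=.
  - by rewrite D0t /ph addrC !addrA H2.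
  - by rewrite addr0 /ph addrC H2.
  - by rewrite add0r D2t /ph addrC addrA (addrC al).
exists f; split.
  by split=> // g /SuppP [->|[i [t ->]]]; rewrite ?f0 ?d0 ?fd.
move=> f' [f'M f'd]; apply/funext => g.
have E i t : f (deg_iota i + deg_T t) = f' (deg_iota i + deg_T t).
  by rewrite fd f'd ?SuppE.
have E1 i : f (deg_iota i) = f' (deg_iota i).
  by have := E i 0; rewrite /deg_T row_mx0 addr0.
have ET t : f (deg_T t) = f' (deg_T t).
  by apply: (addrI (f (deg_iota 1))); rewrite -fD E1 -(zf _ f'M).
have -> : g = row_mx (L g) 0 + deg_T (Rs g).
  by rewrite /deg_T (@add_row_mx _ 1 2 3) addr0 add0r (@hsubmxK _ 1 2 3).
have -> : row_mx (L g) 0 = (if L g 0 0 == 0 then 0 else deg_a)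
                         + (if L g 0 1 == 0 then 0 else deg_b) :> Z2_5.
  have e (b : bool) v : (if b then 0 else row_mx v 0)
      = row_mx (if b then 0 else v) (0 : 'rV_3) :> 'rV['F_2]_(2 + 3).
    by case: b; rewrite ?row_mx0.
  rewrite /deg_a /deg_b [X in X + _]e [X in _ + X]e (@add_row_mx _ 1 2 3) addr0.
  congr row_mx; apply/rowP => j; move: (L g) => v.
  have jP : j = 0 \/ j = 1.
    by case: j => [[|[|//]] p]; [left|right]; apply: val_inj.
  by case: jP => ->; rewrite mxE; move: (v 0 0) (v 0 1);
    case=> [[|[|//]] ?]; case=> [[|[|//]] ?]; rewrite /= !mxE; apply/eqP.
have fz : f' 0 = 0 by apply: (addrI (f' 0)); rewrite -(zf _ f'M) !addr0.
rewrite !fD !(zf _ f'M) ET; congr (_ + _ + _); case: eqP => _; rewrite ?f0 ?fz //.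
  exact: (E1 1).
exact: (E1 2).
Qed.
End C.

End AlbertFacts.

Section Consequences.
Variable F : fieldType.
Hypothesis charF : 2%N \notin [pchar F].

Let two_neq0 : (2 : F) != 0.
Proof. by move: charF; rewrite inE /= -[2%:R]/(2 : F). Qed.

Lemma albert_mul_mx (X Y : albert F) :
  albert_mx (albert_mul X Y) = jordan_mx X Y.
Proof. exact: AlbertFacts.albert_mulP. Qed.

Lemma Z2_5_grading_is_grading :
  is_grading (@albert_mul F) (@Z2_5_grading F).
Proof. exact: AlbertFacts.Gam_grading. Qed.

Lemma Z2_5_grading_universal :
  is_universal (@albert_mul F) (@Z2_5_grading F).
Proof. exact: AlbertFacts.albert_universal. Qed.

End Consequences.

(* Main.v *)
From HB Require Import structures.
Require Import Defs.
From mathcomp Require Import all_boot all_order all_algebra all_fingroup.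
From mathcomp Require Import boolp classical_sets ring.

(** Write an element of Z_2^5 as (p, t), with p in Z_2^2 and t in Z_2^3, so
    that T is the subgroup p = 0. Every (p, t) with p != 0 is the degree of
    some iota_i (w_t), and the only other degree is 0: the complement of the
    support is T without 0. An automorphism of Z_2^5 induced by an automorphism
    of the graded algebra permutes the support and fixes 0, hence preserves T;
    this is [Weyl_albert_T].

    Conversely, let mu preserve T. Then mu permutes the three cosets
    deg (iota_i) + T by a permutation pi of the indices, acts on T by some
    linear bijection g, and sends deg (iota_i) + t to deg (iota_(pi i)) + g t +
    s_i with s_0 + s_1 + s_2 = 0. Three kinds of automorphisms of the Albert
    algebra realize the three ingredients.

    - g: an automorphism of the Cayley algebra, applied to the three
      off-diagonal entries. The Cayley-Dickson construction presents the Cayley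
      algebra by w_1, w_2, w_3 with w_i^2 = 1, subject to relations that hold
      for any three homogeneous elements of independent degrees, once rescaled
      to have square 1. So w_i can be sent to a multiple of the monomial of
      degree g c_i ([cayley_graded_aut]). The scalars needed are fourth roots
      of unity.
    - s: for u of norm 1, the Moufang identity (ux)(yu) = u(xy)u makes the maps
      x |-> x bar u, x |-> bar u x, x |-> u x u a related triple, that is, they
      act on the three off-diagonal entries as one automorphism of the Albert
      algebra. With u a multiple of w_s it shifts the degrees by (s, s, 0)
      ([translation_triple]); such triples and their rotations reach all (s_0,
      s_1, s_2) of sum 0.
    - pi: simultaneous permutation of rows and columns, which conjugates the
      off-diagonal entries when the permutation is odd ([index_perm_aut]).

    Any automorphism of the algebra that sends each component of degree g into
    the one of degree mu g induces mu ([Weyl_in_AutI]), so the composite of the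
    three shows that mu is in the Weyl group ([T_Weyl_albert]). *)

Set Implicit Arguments.
Unset Strict Implicit.
Unset Printing Implicit Defensive.

Import GRing.Theory AlbertFacts.

(** * Automorphisms of the degree group and the Weyl group *)

Section GradingAut.
Local Open Scope ring_scope.
Variables (F : fieldType) (A : vectType F) (mul : A -> A -> A).
Variables (G : finZmodType) (Gam : G -> {vspace A}).

Lemma AutD (u : {perm G}) : u \in Aut [set: G]%SET -> {morph u : x y / x + y}.
Proof.
rewrite inE => /andP[_ /morphicP uM] x y.
by apply: uM; rewrite inE.
Qed.

Lemma additive0 (u : G -> G) : {morph u : x y / x + y} -> u 0 = 0.
Proof. by move=> uD; apply: (addrI (u 0)); rewrite -uD !addr0. Qed.

Lemma Weyl_in_Aut_Supp (u : {perm G}) :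
  Weyl_in_Aut mul Gam u -> {in Supp Gam, forall s, u s \in Supp Gam}.
Proof.
move=> [_ [w [phi [[k0 _] _] <-] /(_ phi) uI]] s sS.
have id_Stab : Stab_gr mul Gam \1%VF.
  split=> [|g _]; last by rewrite lim1g.
  by split=> [|x y]; [apply/eqP/lker0P => x y | ]; rewrite !lfunE.
have {}uI : induces Gam phi u by apply: uI; exists \1%VF; rewrite ?comp_lfun1r.
move: (sS); rewrite !inE -(uI s sS) -!dimv_eq0 limg_dim_eq //.
by rewrite k0 capv0.
Qed.

(** Inclusions suffice: phi is injective and u permutes the degrees, so both
    families of dimensions have the same sum and no inclusion is strict. *)
Lemma Weyl_in_AutI (u : {perm G}) (phi : 'End(A)) :
  u \in Aut [set: G]%SET -> is_alg_aut mul phi ->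
  (forall g x, x \in Gam g -> phi x \in Gam (u g)) -> Weyl_in_Aut mul Gam u.
Proof.
move=> uA aphi shift; have [k0 _] := aphi.
have dimE (U : {vspace A}) : \dim (phi @: U) = \dim U.
  by rewrite limg_dim_eq // k0 capv0.
have sub g : (phi @: Gam g <= Gam (u g))%VS.
  by apply/subvP => _ /memv_imgP[x xg ->]; apply: shift.
have phiE g : (phi @: Gam g)%VS = Gam (u g).
  apply/eqP; rewrite eqEdim sub dimE /=.
  have le h : (\dim (Gam h) <= \dim (Gam (u h)) ?= iff
      (\dim (Gam h) == \dim (Gam (u h))))%N.
    by split=> //; rewrite -dimE dimvS.
  have [_] := leqif_sum (fun h (_ : xpredT h) => le h).
  rewrite [X in _ == X](_ : _ = \sum_h \dim (Gam h))%N; last first.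
    by rewrite [RHS](reindex_inj (@perm_inj _ u)).
  by rewrite eqxx => /esym/forallP/(_ g)/eqP ->.
have SuppE s : (u s \in Supp Gam) = (s \in Supp Gam).
  by rewrite !inE -phiE -!dimv_eq0 dimE.
have aut_phi : Aut_gr mul Gam phi.
  split=> //; apply/seteqP; split=> [_ [_ [s sS <-] <-]|_ [s sS <-]].
    by exists (u s); rewrite /= ?SuppE ?phiE.
  exists (Gam (u^-1%g s)); last by rewrite phiE permKV.
  by exists (u^-1%g s); rewrite //= -SuppE permKV.
split=> //; eexists; first by exists phi.
by move=> _ [sigma [_ st] <-] s sS; rewrite limg_comp st.
Qed.
End GradingAut.

Section LinearMaps.
Local Open Scope ring_scope.
Variable F : fieldType.

Lemma linear_lfun (aT rT : vectType F) (f : aT -> rT) :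
  linear f -> exists phi : 'Hom(aT, rT), phi =1 f.
Proof.
move=> lf.
pose fL : {linear aT -> rT} := HB.pack f (GRing.isLinear.Build F aT rT _ f lf).
by exists (linfun fL) => x; rewrite lfunE.
Qed.
End LinearMaps.

(** * Identities of the Cayley algebra and related triples *)

Section CayleyIdentities.
Local Open Scope ring_scope.
Variable F : fieldType.
Local Notation C := (cayley F).
Local Notation polar := (@cayley_polar F).
Local Notation norm := (@cayley_norm F).
Local Notation bar := (@cayley_bar F).
Local Notation "x ** y" := (cayley_mul x y) (at level 40, left associativity).
Implicit Types u x y z : C.

Lemma Z3_add11 : 1 + 1 = 2 :> 'Z_3. Proof. exact: val_inj. Qed.
Lemma Z3_add12 : 1 + 2 = 0 :> 'Z_3. Proof. exact: val_inj. Qed.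
Lemma Z3_add21 : 2 + 1 = 0 :> 'Z_3. Proof. exact: val_inj. Qed.
Lemma Z3_add22 : 2 + 2 = 1 :> 'Z_3. Proof. exact: val_inj. Qed.
(** Indices modulo 3 do not simplify by themselves: 1 + 2 and 0 are only
   propositionally the same element of 'Z_3. *)
Definition Z3_addE :=
  (@add0r 'Z_3, @addr0 'Z_3, Z3_add11, Z3_add12, Z3_add21, Z3_add22).

Lemma scaleCE a x s : (a *: x) s = a * x s.
Proof. by rewrite ffunE. Qed.

Lemma polarC x y : polar x y = polar y x.
Proof. by rewrite !polarE !Z3_sum; ring. Qed.

Lemma polarDl x y z : polar (x + y) z = polar x z + polar y z.
Proof. by rewrite !polarE !Z3_sum !ffunE; ring. Qed.

Lemma polarZl a x y : polar (a *: x) y = a * polar x y.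
Proof. by rewrite -[y in LHS]scale1r cayley_polarZ mulr1. Qed.

Lemma polar_bar x y : polar (bar x) y = polar x (bar y).
Proof. by rewrite -[y in LHS]barK polarbar. Qed.

Lemma polar_mull x y z : polar (x ** y) z = polar y (bar x ** z).
Proof. by rewrite !polarE !Z3_sum !(mulE, Z3_sum, barE, Z3_addE); ring. Qed.

Lemma polar_mulr x y z : polar (x ** y) z = polar x (z ** bar y).
Proof.
by rewrite -(polarbar (x ** y)) barM polar_mull barK polar_bar barM barK.
Qed.

Lemma mulKbar u x : bar u ** (u ** x) = norm u *: x.
Proof.
apply/ffunP => -[||i|i]; try (move: i; apply: Z3_ind);
  by rewrite ffunE /cayley_norm /GRing.scale ?(mulE, Z3_sum, barE, Z3_addE) /=; ring.
Qed.

Lemma norm_bar u : norm (bar u) = norm u.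
Proof. by rewrite /cayley_norm !Z3_sum !barE; ring. Qed.

Lemma mulbarK u x : x ** u ** bar u = norm u *: x.
Proof.
apply: (can_inj (@barK F)); rewrite !barM barK barZ.
by rewrite -{1}(barK u) mulKbar norm_bar.
Qed.

Lemma polar_mul2l u x y : polar (u ** x) (u ** y) = norm u * polar x y.
Proof. by rewrite polar_mull mulKbar polarC polarZl polarC. Qed.

Lemma polar_mul2r u x y : polar (x ** u) (y ** u) = norm u * polar x y.
Proof. by rewrite polar_mulr mulbarK polarC polarZl polarC. Qed.

Lemma norm_double u : polar u u = 2 * norm u.
Proof. by rewrite polarE /cayley_norm !Z3_sum; ring. Qed.

(** Linearization, in both factors, of the multiplicativity of the norm. *)
Lemma polar_exchange x y z t :
  polar (x ** y) (z ** t) = polar x z * polar y t - polar (x ** t) (z ** y).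
Proof.
apply/eqP; rewrite -subr_eq0; apply/eqP.
by rewrite !polarE !Z3_sum !(mulE, Z3_sum, Z3_addE); ring.
Qed.

Lemma polar_nondeg x y : (forall z, polar x z = polar y z) -> x = y.
Proof.
have E s : exists z, forall v : C, v s = polar v z.
  case: s => [||i|i];
    [exists (cb F Be2)|exists (cb F Be1)|exists (cb F (Bv i))|exists (cb F (Bu i))];
    move=> v; try (move: i; apply: Z3_ind);
    by rewrite polarE !Z3_sum !ffunE !cbE /=; ring.
by move=> e; apply/ffunP => s; have [z zE] := E s; rewrite !zE.
Qed.

(** Both sides have the same pairing with every z. Moving a factor to the
    other argument of the polar form and exchanging reduces either pairing to
    n(u, z) n(xy, bar u) - n(u) n(yz, bar x). *)
Lemma moufang u x y : (u ** x) ** (y ** u) = u ** (x ** y) ** u.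
Proof.
apply: polar_nondeg => z.
have xuu : bar x ** bar u ** u = norm u *: bar x.
  by rewrite -{2}(barK u) mulbarK norm_bar.
have uu : u ** bar u = norm u *: cayley1 F.
  by rewrite -[u in u ** _]mul1C mulbarK.
rewrite polar_mull polar_exchange barM xuu [RHS]polar_mulr polar_exchange uu.
rewrite (polarC (y ** z)) !polarZl (polarC (bar x)) polar_mulr.
rewrite (polarC (cayley1 F)) (polar_mull z) mulC1 !(polar_mull x).
by rewrite [X in X - _]mulrC.
Qed.

(** Up to a factor, the trilinear trace form of the Albert algebra on the three
    off-diagonal entries. *)
Definition triform x y z : F := polar (bar x ** bar y) z.

Lemma triform_rot x y z : triform x y z = triform y z x.
Proof. by rewrite /triform polar_mulr barK polar_bar barM polarC. Qed.

(** Stated with forms rather than products, because forms make the condition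
    invariant under rotating the three indices; the product rule follows by
    nondegeneracy. *)
Definition related_triple (T : 'Z_3 -> 'End(C)) : Prop :=
  (forall i x y, polar (T i x) (T i y) = polar x y) /\
  (forall x y z, triform (T 0 x) (T 1 y) (T 2 z) = triform x y z).

Lemma isometry_lker0 (phi : 'End(C)) :
  (forall x y, polar (phi x) (phi y) = polar x y) -> lker phi = 0%VS.
Proof.
move=> iso; apply/eqP/lker0P => x y e; apply: polar_nondeg => z.
by rewrite -iso e iso.
Qed.

Lemma related_tripleM T U : related_triple T -> related_triple U ->
  related_triple (fun i => (T i \o U i)%VF).
Proof.
by move=> [Tp Tt] [Up Ut]; split=> *; rewrite !lfunE /= ?Tp ?Up ?Tt ?Ut.
Qed.

Lemma related_triple_triform T i x y z : related_triple T ->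
  triform (T i x) (T (i + 1) y) (T (i + 2) z) = triform x y z.
Proof.
case=> _ Tt; move: i; apply: Z3_ind; rewrite ?Z3_addE //.
  by rewrite -triform_rot Tt triform_rot.
by rewrite triform_rot Tt -triform_rot.
Qed.

Lemma related_triple_rot T k : related_triple T ->
  related_triple (fun i => T (i + k)).
Proof.
move=> relT; split=> [i|x y z]; first by case: relT.
by rewrite add0r (addrC 1) (addrC 2) related_triple_triform.
Qed.

(** An injective endomorphism is onto, so pairing with all T i t, where the
    trilinear form is invariant, suffices to identify the product. *)
Lemma related_triple_mul T i x y : related_triple T ->
  T i (bar x ** bar y) = bar (T (i + 1) x) ** bar (T (i + 2) y).
Proof.
move=> relT; have [Tp _] := relT; apply: polar_nondeg => t.
have k0 := introT eqP (isometry_lker0 (Tp i)).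
have -> : t = T i ((T i)^-1%VF t) by rewrite lker0_lfunVK.
rewrite Tp -/(triform _ _ _) -[RHS]/(triform _ _ _).
by rewrite -[RHS]triform_rot related_triple_triform // [RHS]triform_rot.
Qed.

(** The trilinear form of x bar u, bar u y and z' = u z u pairs z' with
    (u bar x) (bar y u), which is u (bar x bar y) u by the Moufang identity, and
    multiplications by u are isometries. *)
Lemma moufang_triple u : norm u = 1 ->
  exists2 T, related_triple T &
    forall x, [/\ T 0 x = x ** bar u, T 1 x = bar u ** x & T 2 x = u ** x ** u].
Proof.
move=> u1; have nb1 : norm (bar u) = 1 by rewrite norm_bar.
pose f (i : 'Z_3) x := if i == 0 then x ** bar u
  else if i == 1 then bar u ** x else u ** x ** u.
have /choice[T TE] i : exists phi : 'End(C), phi =1 f i.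
  apply: linear_lfun => a x y; rewrite /f.
  case: ifP => _; first by rewrite mulDl mulZl.
  by case: ifP => _; rewrite mulDr mulZr // mulDl mulZl.
exists T; last by split; rewrite TE.
split=> [i x y|x y z]; rewrite !TE /f /=.
  by case: ifP => _; last case: ifP => _;
    rewrite ?(polar_mul2l, polar_mul2r, u1, nb1, mul1r).
rewrite /triform !barM barK moufang.
by rewrite polar_mul2r polar_mul2l u1 !mul1r.
Qed.

(** The norm comes for free from x bar y + y bar x = n(x, y) 1. *)
Lemma automorphism_triple (phi : 'End(C)) :
  (forall x y, phi (x ** y) = phi x ** phi y) ->
  (forall x, phi (bar x) = bar (phi x)) -> phi (cayley1 F) = cayley1 F ->
  related_triple (fun=> phi).
Proof.
move=> phiM phib phi1.
have iso x y : polar (phi x) (phi y) = polar x y.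
  have : phi (polar x y *: cayley1 F) = polar (phi x) (phi y) *: cayley1 F.
    by rewrite -!xbary linearD /= !phiM !phib.
  rewrite linearZ /= phi1 => /ffunP/(_ Be1); rewrite !scaleCE oneE !mulr1.
  by move->.
by split=> // x y z; rewrite /triform -!phib -phiM iso.
Qed.
End CayleyIdentities.

(** * Signs in the product of homogeneous elements *)

Section MonomialSigns.
Local Notation b3 := (bool * bool * bool)%type.
Implicit Types b c g : b3.

Definition zerob3 : b3 := (false, false, false).

(** The exponent of the sign in w_b w_c = +-w_(b + c). The bilinear part says
    that w_i and w_j anticommute for i != j and that w_i^2 = 1; the cubic part,
    a polarization of t1 t2 t3, carries the nonassociativity. *)
Definition wsign b c : bool :=
  let: (x1, x2, x3) := b in let: (y1, y2, y3) := c in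
  (x2 && y1) (+) (x3 && y1) (+) (x3 && y2)
  (+) (x1 && y2 && y3) (+) (x2 && y1 && y3) (+) (x3 && y1 && y2).

Definition scaleb3 (k : bool) b : b3 := (k && b.1.1, k && b.1.2, k && b.2).

Definition lincombb3 g1 g2 g3 b : b3 :=
  addb3 (addb3 (scaleb3 b.1.1 g1) (scaleb3 b.1.2 g2)) (scaleb3 b.2 g3).

(** The exponent of the sign in (w_g1^b1 w_g2^b2) w_g3^b3 = +-w_(b1 g1 + b2 g2 +
    b3 g3). *)
Definition monomial_sign g1 g2 g3 b : bool :=
  wsign (scaleb3 b.1.1 g1) (scaleb3 b.1.2 g2)
  (+) wsign (addb3 (scaleb3 b.1.1 g1) (scaleb3 b.1.2 g2)) (scaleb3 b.2 g3).

(** The sign contributed by the squares of w_g1, w_g2, w_g3 when two monomials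
    in them are multiplied. *)
Definition square_sign g1 g2 g3 b c : bool :=
  (b.1.1 && c.1.1 && wsign g1 g1) (+) (b.1.2 && c.1.2 && wsign g2 g2)
  (+) (b.2 && c.2 && wsign g3 g3).

(** The monomials in w_g1, w_g2, w_g3, once these are rescaled to have square
    1, multiply by the same signs as the monomials in w_1, w_2, w_3. The reason
    is the invariance of commutators and associators: homogeneous elements
    anticommute when their degrees are distinct and nonzero, and associate up
    to the sign given by the determinant of their degrees. As there are only
    168 bases of Z_2^3, evaluation over all of them proves the identity. *)
Lemma wsign_change_basis g1 g2 g3 b c :
  (forall d, lincombb3 g1 g2 g3 d = zerob3 -> d = zerob3) ->
  monomial_sign g1 g2 g3 b (+) monomial_sign g1 g2 g3 c
    (+) wsign (lincombb3 g1 g2 g3 b) (lincombb3 g1 g2 g3 c)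
    (+) square_sign g1 g2 g3 b c
  = monomial_sign g1 g2 g3 (addb3 b c) (+) wsign b c.
Proof.
move=> free.
pose indep h1 h2 h3 :=
  all (fun d => (lincombb3 h1 h2 h3 d == zerob3) ==> (d == zerob3)) b3s.
pose identity h1 h2 h3 b c :=
  monomial_sign h1 h2 h3 b (+) monomial_sign h1 h2 h3 c
    (+) wsign (lincombb3 h1 h2 h3 b) (lincombb3 h1 h2 h3 c)
    (+) square_sign h1 h2 h3 b c
  == monomial_sign h1 h2 h3 (addb3 b c) (+) wsign b c.
have ok : all (fun h1 => all (fun h2 => all (fun h3 => indep h1 h2 h3 ==>
    all (fun b => all (fun c => identity h1 h2 h3 b c) b3s) b3s) b3s) b3s) b3s.
  by vm_compute.
have indep_g : indep g1 g2 g3.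
  by apply/allP => d _; apply/implyP => /eqP/free ->.
have {ok} := b3sP (b3sP (b3sP ok g1) g2) g3; rewrite indep_g => ok.
exact/eqP/(b3sP (b3sP ok b) c).
Qed.

Lemma imul_wmi b c : eqi (imul (wmi b) (wmi c))
  (fun s => (sgi (wsign b c) * wmi (addb3 b c) s)%R).
Proof.
have ok : all (fun b => all (fun c => eqi (imul (wmi b) (wmi c))
    (fun s => (sgi (wsign b c) * wmi (addb3 b c) s)%R)) b3s) b3s by vm_compute.
exact: (b3sP (b3sP ok b) c).
Qed.
End MonomialSigns.

(** * Automorphisms of the Cayley algebra permuting the components *)

Section CayleyGradedAut.
Local Open Scope ring_scope.
Variable F : closedFieldType.
Hypothesis n2 : (2 : F) != 0.
Local Notation C := (cayley F).
Local Notation V := 'rV['F_2]_3.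
Local Notation w := (@w_mon F).
Local Notation polar := (@cayley_polar F).
Local Notation norm := (@cayley_norm F).
Local Notation bar := (@cayley_bar F).
Local Notation "x ** y" := (cayley_mul x y) (at level 40, left associativity).

Lemma closed_sqrt (a : F) : exists x, x ^+ 2 = a.
Proof.
have [x xE] := @solve_monicpoly F 2 (fun i => if i == 0%N then a else 0) isT.
by exists x; rewrite xE big_ord_recl big_ord1 /= mul0r addr0 expr0 mulr1.
Qed.

Lemma w_mulE s t : w s ** w t = (-1) ^+ wsign (tb s) (tb t) *: w (s + t).
Proof.
rewrite !w_monE embM (eqiP F (imul_wmi _ _)) tbD; apply/ffunP => r.
have sgiE (k : bool) : (sgi k)%:~R = (-1) ^+ k :> F by case: k.
by rewrite !ffunE rmorphM /= sgiE.
Qed.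

Lemma tb0 : tb 0 = zerob3. Proof. by rewrite /tb !mxE. Qed.

Lemma w_0 : w 0 = cayley1 F.
Proof. by rewrite /w_mon !mxE /w_pow !eqxx !mul1C. Qed.

Lemma bar_w t : t != 0 -> bar (w t) = - w t.
Proof.
by move=> t0; rewrite /cayley_bar -w_0 w_monP // scale0r sub0r.
Qed.

Lemma cayley_w_ind (P : C -> Prop) :
  P 0 -> (forall x y, P x -> P y -> P (x + y)) ->
  (forall k x, P x -> P (k *: x)) -> (forall t, P (w t)) -> forall x, P x.
Proof.
move=> P0 PD PZ Pw x; have : x \in fullv by rewrite memvf.
rewrite -(cayley_span n2) => /memv_sumP[f fw ->].
apply: (big_rec P) => // t y _ Py; apply: PD => //.
by have /vlineP[k ->] := fw t isT; apply: PZ.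
Qed.

(** The w_t form an orthogonal basis, so the polar form gives the coordinates. *)
Lemma w_linear_ext (v : V -> C) : exists phi : 'End(C), forall t, phi (w t) = v t.
Proof.
have [|phi phiE] := @linear_lfun F C C
  (fun x => \sum_t (polar x (w t) / polar (w t) (w t)) *: v t).
  move=> a x y; rewrite scaler_sumr -big_split /=; apply: eq_bigr => t _.
  by rewrite polarDl polarZl mulrDl scalerDl scalerA mulrA.
exists phi => t; rewrite phiE (bigD1 t) //= big1 => [|s st].
  by rewrite addr0 divff ?scale1r // w_monPn.
by rewrite w_monP ?mul0r ?scale0r // eq_sym.
Qed.

Lemma tb_additive (g : V -> V) t : {morph g : x y / x + y} ->
  tb (g t) = lincombb3 (tb (g (delta_mx 0 0))) (tb (g (delta_mx 0 1)))
                       (tb (g (delta_mx 0 2))) (tb t).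
Proof.
move=> gD; have g0 := additive0 gD.
have F2E (a : 'F_2) : a = (a != 0)%:R by case: a => [[|[|//]] ?]; apply/eqP.
have tE : t = \sum_j (t 0 j != 0)%:R *: delta_mx 0 j.
  by rewrite {1}[t]row_sum_delta; apply: eq_bigr => j _; rewrite -F2E.
have {tE} tE : t = (t 0 0 != 0)%:R *: delta_mx 0 0
    + (t 0 1 != 0)%:R *: delta_mx 0 1 + (t 0 2 != 0)%:R *: delta_mx 0 2.
  rewrite {1}tE; exact: (Z3_sum (fun j => (t 0 j != 0)%:R *: delta_mx 0 j)).
have gs (k : bool) e : tb (g (k%:R *: e)) = scaleb3 k (tb (g e)).
  case: k; last by rewrite scale0r g0 tb0.
  by rewrite scale1r; case: (tb (g e)) => [[]].
by rewrite {1}tE !gD !tbD !gs.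
Qed.

(** The universal property of the Cayley-Dickson doublings: w_i is sent to
    r_i w_(g c_i), with r_i chosen so that the square is 1. Hence w_t goes to
    the corresponding monomial, which is coef t times w_(g t). *)
Lemma cayley_graded_aut (g : V -> V) :
  {morph g : x y / x + y} -> injective g ->
  exists2 phi : 'End(C), related_triple (fun=> phi) &
    forall t, phi (w t) \in <[w (g t)]>%VS.
Proof.
move=> gD g_inj; have g0 := additive0 gD.
pose g1 := tb (g (delta_mx 0 0)); pose g2 := tb (g (delta_mx 0 1)).
pose g3 := tb (g (delta_mx 0 2)).
have gE t : tb (g t) = lincombb3 g1 g2 g3 (tb t) by apply: tb_additive.
have free d : lincombb3 g1 g2 g3 d = zerob3 -> d = zerob3.
  pose t : V := \row_j (nth 0 [:: d.1.1%:R; d.1.2%:R; d.2%:R] j).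
  have <- : tb t = d.
    by rewrite /tb !mxE /=; case: d {t} => [[[] []] []].
  by rewrite -gE -!tb0 => /tb_inj gt0; congr tb; apply: g_inj; rewrite gt0.
pose sgn b : F := (-1) ^+ b.
have [r1 r1E] := closed_sqrt (sgn (wsign g1 g1)).
have [r2 r2E] := closed_sqrt (sgn (wsign g2 g2)).
have [r3 r3E] := closed_sqrt (sgn (wsign g3 g3)).
pose pw (r : F) (k : bool) := if k then r else 1.
have pwD r (s k l : bool) : r ^+ 2 = sgn s ->
    pw r k * pw r l = sgn (k && l && s) * pw r (k (+) l).
  move=> rE; rewrite /pw /sgn; case: k; case: l => /=.
  - by rewrite mulr1 -expr2.
  - by rewrite expr0 mulrC.
  - by rewrite expr0.
  - by rewrite expr0.
pose coef b : F := sgn (monomial_sign g1 g2 g3 b)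
  * (pw r1 b.1.1 * pw r2 b.1.2 * pw r3 b.2).
have sgnD b c : sgn (b (+) c) = sgn b * sgn c by rewrite /sgn signr_addb.
have coefM b c :
    coef b * coef c * sgn (wsign (lincombb3 g1 g2 g3 b) (lincombb3 g1 g2 g3 c))
    = coef (addb3 b c) * sgn (wsign b c).
  (* Collect the powers of each r_j; the signs are then those of the change of
     basis. *)
  have e := wsign_change_basis b c free; rewrite /coef [RHS]mulrAC -sgnD -e.
  have p1 := pwD _ _ b.1.1 c.1.1 r1E; have p2 := pwD _ _ b.1.2 c.1.2 r2E.
  have p3 := pwD _ _ b.2 c.2 r3E; move: p1 p2 p3.
  rewrite /square_sign [addb3 b c]/=.
  move: (monomial_sign _ _ _ b) (monomial_sign _ _ _ c).
  move: (wsign (lincombb3 _ _ _ _) _) => m mb mc.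
  move: (b.1.1 && _ && _) (b.1.2 && _ && _) (b.2 && _ && _).
  move=> q1 q2 q3 p1 p2 p3.
  transitivity (sgn mb * sgn mc * sgn m * ((pw r1 b.1.1 * pw r1 c.1.1)
    * (pw r2 b.1.2 * pw r2 c.1.2) * (pw r3 b.2 * pw r3 c.2))); first by ring.
  by rewrite p1 p2 p3 !sgnD; ring.
have [phi phiE] := w_linear_ext (fun t => coef (tb t) *: w (g t)).
have phi1 : phi (cayley1 F) = cayley1 F.
  by rewrite -w_0 phiE g0 tb0 /coef /pw /sgn /= expr0 !mulr1 scale1r.
exists phi; last by move=> t; rewrite phiE memvZ ?memv_line.
apply: automorphism_triple => // [x y|x].
- elim/cayley_w_ind: x => [|x x' ih ih'|k x ih|s].
  + by rewrite linear0 !zl linear0.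
  + by rewrite !linearD /= !mulDl linearD /= ih ih'.
  + by rewrite !linearZ /= !mulZl linearZ /= ih.
  elim/cayley_w_ind: y => [|x x' ih ih'|k x ih|t].
  + by rewrite linear0 -(scale0r (0 : C)) !mulZr !scale0r linear0.
  + by rewrite !linearD /= !mulDr linearD /= ih ih'.
  + by rewrite !linearZ /= !mulZr linearZ /= ih.
  rewrite w_mulE linearZ /= !phiE mulZl mulZr w_mulE !scalerA gD tbD !gE.
  by rewrite coefM mulrC.
elim/cayley_w_ind: x => [|x x' ih ih'|k x ih|t].
+ by rewrite zb linear0 zb.
+ rewrite (barD x x') (linearD phi (bar x)) (linearD phi x) (barD (phi x)).
  by rewrite -ih -ih'.
+ rewrite (barZ k x) (linearZ _ (bar x)) (linearZ _ x) /= (barZ k (phi x)).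
  by rewrite -ih.
rewrite phiE; have [->|t0] := eqVneq t 0.
  by rewrite g0 w_0 barZ !bar1 -w_0 phiE g0 w_0.
have gt0 : g t != 0 by apply: contra_neq t0 => gt0; apply: g_inj; rewrite gt0.
by rewrite barZ !bar_w // linearN /= phiE scalerN.
Qed.

Lemma unit_norm_w s : exists u, u \in <[w s]>%VS /\ norm u = 1.
Proof.
have ns : norm (w s) != 0.
  by apply: contraNneq (w_monPn s n2) => n0; rewrite norm_double n0 mulr0.
have [k kE] := closed_sqrt (norm (w s))^-1.
exists (k *: w s); split; first by rewrite memvZ ?memv_line.
apply: (mulfI n2); rewrite -norm_double cayley_polarZ norm_double -expr2 kE.
by rewrite mulrCA mulVf.
Qed.

(** Left and right multiplication by u, a multiple of w_s, shift the degree by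
    s, so x |-> u x u does not shift it. *)
Lemma translation_triple s :
  exists2 T : 'Z_3 -> 'End(C), related_triple T & forall t,
    [/\ T 0 (w t) \in <[w (t + s)]>%VS, T 1 (w t) \in <[w (t + s)]>%VS
      & T 2 (w t) \in <[w t]>%VS].
Proof.
have [u [us u1]] := unit_norm_w s; have [T relT TE] := moufang_triple u1.
have line_mul x y a b : x \in <[w a]>%VS -> y \in <[w b]>%VS ->
    x ** y \in <[w (a + b)]>%VS.
  by move=> /vlineP[k ->] /vlineP[l ->]; rewrite mulZl mulZr !memvZ // w_monM.
have bus : bar u \in <[w s]>%VS.
  by have /vlineP[k ->] := us; rewrite barZ memvZ // w_mon_bar.
have ss : s + s = 0.
  by apply/rowP => i; rewrite !mxE; case: (s 0 i) => [[|[|//]] ?]; apply/eqP.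
exists T => // t; have [-> -> ->] := TE (w t); have wt := memv_line (w t).
split; first exact: line_mul.
  by rewrite addrC; apply: line_mul.
rewrite (_ : <[w t]>%VS = <[w (s + t + s)]>%VS); last first.
  by rewrite (addrC s) -addrA ss addr0.
exact: line_mul (line_mul _ _ _ _ us wt) us.
Qed.

Lemma lfun_line (phi : 'End(C)) s t x :
  phi (w t) \in <[w s]>%VS -> x \in <[w t]>%VS -> phi x \in <[w s]>%VS.
Proof. by move=> phit /vlineP[k ->]; rewrite linearZ memvZ. Qed.

(** The shifts (s0, s0, 0) and (0, s2, s2) add up to (s0, s0 + s2, s2). *)
Lemma graded_triple (g : V -> V) (s : 'Z_3 -> V) :
  {morph g : x y / x + y} -> injective g -> s 1 = s 0 + s 2 ->
  exists2 T : 'Z_3 -> 'End(C), related_triple T &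
    forall i t, T i (w t) \in <[w (g t + s i)]>%VS.
Proof.
move=> gD g_inj s1.
have [phi relphi phiE] := cayley_graded_aut gD g_inj.
have [T relT TE] := translation_triple (s 0).
have [U relU UE] := translation_triple (s 2).
exists (fun i => (U (i + 2) \o (T i \o phi))%VF).
  apply: related_tripleM; first exact: related_triple_rot.
  exact: related_tripleM.
move=> i t; rewrite lfunE /= lfunE /=.
have [T0 T1 T2] := TE (g t).
move: i; apply: Z3_ind; rewrite ?Z3_addE.
- have [_ _ U2] := UE (g t + s 0).
  exact: lfun_line U2 (lfun_line T0 (phiE t)).
- have [U0 _ _] := UE (g t + s 0); rewrite s1 addrA.
  exact: lfun_line U0 (lfun_line T1 (phiE t)).
have [_ U1 _] := UE (g t).
exact: lfun_line U1 (lfun_line T2 (phiE t)).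
Qed.
End CayleyGradedAut.

(** * Automorphisms of the Albert algebra *)

Section AlbertAut.
Local Open Scope ring_scope.
Variable F : fieldType.
Hypothesis n2 : (2 : F) != 0.
Local Notation C := (cayley F).
Local Notation A := (albert F).
Local Notation bar := (@cayley_bar F).
Implicit Types X Y : A.

Lemma albertP X Y : (forall i, X.1 i = Y.1 i) -> (forall i, X.2 i = Y.2 i) -> X = Y.
Proof.
move=> e1 e2; rewrite [X]surjective_pairing [Y]surjective_pairing.
by congr pair; apply/ffunP.
Qed.

(** In a product, off-diagonal entries occur only through the polar form of two
    entries with the same index and through bar x bar y for consecutive ones. *)
Lemma related_triple_aut (T : 'Z_3 -> 'End(C)) : related_triple T ->
  exists2 phi : 'End(A), is_alg_aut (@albert_mul F) phi &
    forall X, (phi X).1 = X.1 /\ forall i, (phi X).2 i = T i (X.2 i).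
Proof.
move=> relT; have [Tp _] := relT.
have Tinj i : injective (T i).
  by apply/lker0P; rewrite (isometry_lker0 (Tp i)).
have [|phi phiE] := @linear_lfun F A A (fun X => (X.1, [ffun i => T i (X.2 i)])).
  move=> a X Y; apply: albertP => i //=; rewrite !ffunE; exact: linearP.
have phi1 X i : (phi X).1 i = X.1 i by rewrite phiE.
have phi2 X i : (phi X).2 i = T i (X.2 i) by rewrite phiE ffunE.
exists phi; last by move=> X; split=> [|i]; [rewrite phiE | exact: phi2].
split=> [|X Y].
  apply/eqP/lker0P => X Y e; apply: albertP => i.
    by rewrite -(phi1 X) -(phi1 Y) e.
  by apply: (Tinj i); rewrite -(phi2 X) -(phi2 Y) e.
apply: albertP => i.
  rewrite (phi1 (albert_mul X Y) i) [LHS](albert_mul1 n2 X Y).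
  rewrite [RHS](albert_mul1 n2 (phi X) (phi Y)).
  by rewrite (phi1 X) (phi1 Y) !(phi2 X) !(phi2 Y) !Tp.
rewrite (phi2 (albert_mul X Y) i) [in LHS]albert_mul2 [RHS]albert_mul2.
rewrite !(phi1 X) !(phi1 Y) !(phi2 X) !(phi2 Y).
rewrite linearZ; congr (_ *: _); rewrite 3!(linearD (T i)) 2!linearZ /=.
by congr (_ + _ + _ + _); exact: related_triple_mul relT.
Qed.

(** Conjugation of Hermitian matrices by a permutation matrix. An odd
    permutation exchanges the roles of an entry and its conjugate. *)
Lemma index_perm_aut (sigma : 'Z_3 -> 'Z_3) : injective sigma ->
  exists2 phi : 'End(A), is_alg_aut (@albert_mul F) phi &
    forall X, (forall i, (phi X).1 i = X.1 (sigma i)) /\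
      forall i, (phi X).2 i = X.2 (sigma i) \/ (phi X).2 i = bar (X.2 (sigma i)).
Proof.
move=> inj; pose odd := sigma 1 != sigma 0 + 1.
pose c (x : C) := if odd then bar x else x.
have cD x y : c (x + y) = c x + c y by rewrite /c; case: (odd); [exact: barD|].
have cZ a x : c (a *: x) = a *: c x by rewrite /c; case: (odd); [exact: barZ|].
have cK : involutive c by move=> x; rewrite /c; case: (odd); [exact: barK|].
have cP x y : cayley_polar (c x) (c y) = cayley_polar x y.
  by rewrite /c; case: (odd); [exact: polarbar|].
have sigmaE i :
    if odd then sigma (i + 1) = sigma i + 2 /\ sigma (i + 2) = sigma i + 1
    else sigma (i + 1) = sigma i + 1 /\ sigma (i + 2) = sigma i + 2.
  have n01 : sigma 0 != sigma 1 by rewrite (inj_eq inj).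
  have n02 : sigma 0 != sigma 2 by rewrite (inj_eq inj).
  have n12 : sigma 1 != sigma 2 by rewrite (inj_eq inj).
  (* Three distinct elements of 'Z_3 are consecutive in one of the two cyclic
     orders; sigma 0 and sigma 1 decide which. *)
  rewrite /odd {odd c cD cZ cK cP}; move: i n01 n02 n12.
  apply: Z3_ind; rewrite ?Z3_addE;
  move: (sigma 0) (sigma 1) (sigma 2);
  by apply: Z3_ind; apply: Z3_ind; apply: Z3_ind => // _ _ _; split; apply: val_inj.
have [|phi phiE] := @linear_lfun F A A
    (fun X => ([ffun i => X.1 (sigma i)], [ffun i => c (X.2 (sigma i))])).
  by move=> a X Y; apply: albertP => i; rewrite /= !ffunE // cD cZ.
have phi1 X i : (phi X).1 i = X.1 (sigma i) by rewrite phiE ffunE.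
have phi2 X i : (phi X).2 i = c (X.2 (sigma i)) by rewrite phiE ffunE.
exists phi; last first.
  by move=> X; split=> // i; rewrite phi2 /c; case: ifP; [right|left].
have [tau tauK sigmaK] := injF_bij inj.
split=> [|X Y].
  apply/eqP/lker0P => X Y e; apply: albertP => i; rewrite -[i]sigmaK.
    by rewrite -(phi1 X) -(phi1 Y) e.
  by apply: (inv_inj cK); rewrite -(phi2 X) -(phi2 Y) e.
apply: albertP => i.
  rewrite (phi1 (albert_mul X Y) i) [LHS](albert_mul1 n2 X Y).
  rewrite [RHS](albert_mul1 n2 (phi X) (phi Y)).
  rewrite !(phi1 X) !(phi1 Y) !(phi2 X) !(phi2 Y) !cP.
  have := sigmaE i; case: (odd) => -[-> ->]; last by [].
  congr (_ + _ * _); exact: addrC.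
rewrite (phi2 (albert_mul X Y) i) [in LHS]albert_mul2 [RHS]albert_mul2.
rewrite !(phi1 X) !(phi1 Y) !(phi2 X) !(phi2 Y).
rewrite cZ 3!cD 2!cZ.
have := sigmaE i; rewrite /c; case: (odd) => -[-> ->]; last by [].
congr (_ *: _); rewrite -[LHS]addrA -[RHS]addrA.
rewrite (addrC (X.1 (sigma i + 1))) (addrC (Y.1 (sigma i + 1))).
congr (_ + _ + _); rewrite [LHS]addrC.
by congr (_ + _); exact: barM.
Qed.
End AlbertAut.

(** * Degrees *)

Section Degrees.
Local Open Scope ring_scope.
Local Notation L := (@lsubmx 'F_2 1 2 3).
Local Notation Rs := (@rsubmx 'F_2 1 2 3).
Implicit Types g : Z2_5.

Lemma deg_T_rsubmx g : L g = 0 -> g = deg_T (Rs g).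
Proof. by move=> Lg; rewrite -[LHS](@hsubmxK _ 1 2 3) Lg. Qed.

Lemma lsubmx_deg_T t : L (deg_T t) = 0.
Proof. exact: row_mxKl. Qed.

Lemma deg_T_additive : {morph deg_T : s t / s + t}.
Proof. by move=> s t; rewrite /deg_T (@add_row_mx _ 1 2 3) addr0. Qed.

Lemma T_subE g : (g \in T_sub) = (L g == 0).
Proof.
apply/idP/eqP => [|Lg0].
  have K_group : group_set [set h : Z2_5 | L h == 0]%SET.
    apply/group_setP; split=> [|h k]; rewrite !inE ?linear0 // => /eqP h0 /eqP k0.
    by rewrite [L _]linearD /= h0 k0 addr0.
  suff /fintype.subsetP/[apply] : T_sub \subset group K_group by rewrite inE => /eqP.
  rewrite gen_subG; apply/fintype.subsetP => _ /imsetP[j _ ->].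
  by rewrite inE lsubmx_deg_T.
rewrite (deg_T_rsubmx Lg0) [Rs g]row_sum_delta.
rewrite (big_morph _ deg_T_additive (id1 := 0)); last exact: row_mx0.
apply: (big_ind (fun h => h \in T_sub)) => [|h k|j _].
- exact: group1.
- exact: groupM.
case: (Rs g 0 j) => [[|[|//]] ?] /=.
  rewrite (_ : Ordinal _ = 0); last exact: val_inj.
  by rewrite scale0r /deg_T row_mx0 group1.
rewrite (_ : Ordinal _ = 1); last exact: val_inj.
by rewrite scale1r mem_gen //; apply/imsetP; exists j.
Qed.

Lemma lsubmx_deg_iota_surj g : L g != 0 -> exists i, L g = L (deg_iota i).
Proof.
have rowP2 (v v' : 'rV['F_2]_2) : v 0 0 = v' 0 0 -> v 0 1 = v' 0 1 -> v = v'.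
  move=> e0 e1; apply/rowP => -[[|[|//]] p];
    [rewrite (_ : Ordinal p = 0)|rewrite (_ : Ordinal p = 1)] => //; exact: val_inj.
have F2P (a : 'F_2) : a = 0 \/ a = 1.
  by case: a => [[|[|//]] ?]; [left|right]; apply: val_inj.
have LE i : L (deg_iota i) = if i == 1 then delta_mx 0 0
    else if i == 2 then delta_mx 0 1 else delta_mx 0 0 + delta_mx 0 1.
  by rewrite /deg_iota; do 2?[case: ifP => _]; rewrite ?linearD /= !row_mxKl.
move: (L g) => v; have [v0|v0] := F2P (v 0 0); have [v1|v1] := F2P (v 0 1) => vn0.
- by case/eqP: vn0; apply: rowP2; rewrite ?v0 ?v1 mxE.
- by exists 2; rewrite LE; apply: rowP2; rewrite ?v0 ?v1 !mxE.
- by exists 1; rewrite LE; apply: rowP2; rewrite ?v0 ?v1 !mxE.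
- by exists 0; rewrite LE; apply: rowP2; rewrite ?v0 ?v1 !mxE; apply: val_inj.
Qed.
End Degrees.

(** * The Weyl group *)

Section WeylGroup.
Local Open Scope ring_scope.
Variable F : closedFieldType.
Hypothesis n2 : (2 : F) != 0.
Local Notation Gam := (@Z2_5_grading F).
Local Notation L := (@lsubmx 'F_2 1 2 3).
Local Notation Rs := (@rsubmx 'F_2 1 2 3).
Implicit Types mu : {perm Z2_5}.

Lemma deg_decomp g i : L g = L (deg_iota i) -> g = deg_iota i + deg_T (Rs g).
Proof. by move=> Lg; apply/esym/eqP; rewrite deg_iotaE Lg !eqxx. Qed.

Lemma Supp_albertE g : (g \in Supp Gam) = (g == 0) || (g \notin T_sub).
Proof.
rewrite T_subE; apply/idP/orP => [/(SuppP n2)[->|[i [t ->]]]|[/eqP->|]].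
- by left.
- by right; rewrite LdT L_iota0.
- exact: Supp0.
by move=> /lsubmx_deg_iota_surj[i /deg_decomp ->]; apply: SuppE.
Qed.

Lemma Weyl_albert_T mu : Weyl_in_Aut (@albert_mul F) Gam mu -> mu @: T_sub = T_sub.
Proof.
move=> W; have [/AutD muD _] := W.
have mu0 := additive0 muD.
have Supp_mu : mu @: Supp Gam = Supp Gam.
  apply/eqP; rewrite eqEcard card_imset ?leqnn ?andbT; last exact: perm_inj.
  by apply/fintype.subsetP => _ /imsetP[s sS ->]; apply: (Weyl_in_Aut_Supp W).
apply/eqP; rewrite eqEcard card_imset ?leqnn ?andbT; last exact: perm_inj.
apply/fintype.subsetP => _ /imsetP[s sT ->]; apply: contraT => musT.
have : mu s \in mu @: Supp Gam by rewrite Supp_mu Supp_albertE musT orbT.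
rewrite mem_imset; last exact: perm_inj.
rewrite Supp_albertE sT orbF => /eqP s0.
by rewrite s0 mu0 group1 in musT.
Qed.

Lemma T_Weyl_albert mu : mu \in Aut [set: Z2_5]%SET -> mu @: T_sub = T_sub ->
  Weyl_in_Aut (@albert_mul F) Gam mu.
Proof.
move=> muA muT; have muD := AutD muA; have mu0 := additive0 muD.
have LmuE x : (L (mu x) == 0) = (L x == 0).
  by rewrite -!T_subE -{1}muT mem_imset //; apply: perm_inj.
pose g t := Rs (mu (deg_T t)); pose s i := Rs (mu (deg_iota i)).
have mu_T t : mu (deg_T t) = deg_T (g t).
  by apply: deg_T_rsubmx; apply/eqP; rewrite LmuE lsubmx_deg_T.
have gD : {morph g : x y / x + y}.
  by move=> x y; rewrite /g deg_T_additive muD linearD.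
have g_inj : injective g.
  move=> x y exy; have /perm_inj : mu (deg_T x) = mu (deg_T y) by rewrite !mu_T exy.
  by case/(@eq_row_mx _ 1 2 3).
have deg1 : deg_iota 1 = deg_iota 0 + deg_iota 2.
  by rewrite /deg_iota /= -addrA F2D addr0.
have s1 : s 1 = s 0 + s 2 by rewrite /s deg1 muD linearD.
have /choice[pi piE] i : exists j, L (mu (deg_iota i)) = L (deg_iota j).
  by apply: lsubmx_deg_iota_surj; rewrite LmuE L_iota0.
have pi_inj : injective pi.
  move=> i j eij; apply: L_iota_inj => /=; apply/eqP.
  rewrite -subr_eq0 -linearB /= -LmuE.
  have -> : deg_iota i - deg_iota j = deg_iota i + deg_iota j.
    by apply/eqP; rewrite subr_eq -addrA F2D addr0.
  by rewrite muD linearD /= !piE eij -linearD /= F2D linear0.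
have mu_iota i t : mu (deg_iota i + deg_T t) = deg_iota (pi i) + deg_T (g t + s i).
  rewrite muD mu_T (deg_decomp (piE i)) -addrA -deg_T_additive.
  by rewrite (addrC (g t)).
have [T relT TE] := graded_triple n2 gD g_inj s1.
(* The i-th entry of the image comes from the entry of index pi^-1 i. *)
pose sigma := invF pi_inj.
have sigma_inj : injective sigma by apply: (can_inj (f_invF pi_inj)).
have [phi aphi phiE] := related_triple_aut n2 relT.
have [psi apsi psiE] := index_perm_aut n2 sigma_inj.
apply: (Weyl_in_AutI muA (is_alg_autM apsi aphi)) => h X /(GamP n2)[X1 X2].
rewrite lfunE /=; have [psi1 psi2] := psiE (phi X).
have [phi1 phi2] := phiE X.
apply/(GamP n2); split=> [muh0|i].
  apply/ffunP => i; rewrite psi1 phi1 X1 ?ffunE //.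
  by apply: contraNneq muh0 => ->; rewrite mu0.
suff H : (phi X).2 (sigma i) \in
    (if L (mu h) == L (deg_iota i) then <[w_mon F (Rs (mu h))]> else 0)%VS.
  have [->//|->] := psi2 i; case: ifP H => _.
    by move=> /vlineP[k ->]; rewrite barZ memvZ // w_mon_bar.
  by rewrite memv0 => /eqP ->; rewrite zb mem0v.
rewrite phi2; have := X2 (sigma i); case: eqP => [Lh|_].
  rewrite [in mu h](deg_decomp Lh) mu_iota f_invF LdT RdT eqxx.
  by move=> /vlineP[k ->]; rewrite linearZ memvZ // TE.
by rewrite memv0 => /eqP ->; rewrite linear0 mem0v.
Qed.
End WeylGroup.

Theorem theorem4p4 (F : closedFieldType) (charF : 2%N \notin [pchar F]%R) :
  Weyl_in_Aut (@albert_mul F) (@Z2_5_grading F) =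
  [set mu : {perm Z2_5} | mu \in Aut [set: Z2_5]%SET /\ mu @: T_sub = T_sub]%classic.
Proof.
have n2 : (2%:R : F)%R != 0%R by move: charF; rewrite inE.
apply/seteqP; split=> [mu W|mu [muA muT]].
  by split; [case: W | exact: Weyl_albert_T W].
exact: T_Weyl_albert.
Qed.
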